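(* Fix a degree $d\ge 1$. Then $\{\mathfrak{R}_{d,m,0}: m=1,2,3,\ldots\}$ is a set of commuting dominant rational endomorphisms of $\mathbb{P}^{2d+1}_{\mathbb{Z}}$, with $\mathfrak{R}_{d,m,0}$ of algebraic degree $m$. More precisely, dehomogenizing and specializing, the maps $\mathfrak{R}_{d,m,0}$ induce commuting dominant polynomial endomorphisms of the affine linear subspaces $$\bigl\{[\boldsymbol a,\boldsymbol b]\in\mathbb{P}^{2d+1}: b_0\ne 0\bigr\}\cong\mathbb{A}^{2d+1}$$ and $$\bigl\{[\boldsymbol a,\boldsymbol b]\in\mathbb{P}^{2d+1}: a_0=0\text{ and }b_0\ne 0\bigr\}\cong\mathbb{A}^{2d}.$$
   Context: Landen transform: for a field $K$ in which $m\neq 0$, with $\zeta_m$ a primitive $m$-th root of unity in an extension of $K$, and $\varphi\in K(z)$, the $(m,0)$-Landen transform $\mathfrak{F}_{m,0}(\varphi)(z)\in K(z)$ is the unique rational function satisfying $\mathfrak{F}_{m,0}(\varphi)(w^m)=\frac{1}{m}\sum_{t=0}^{m-1}\varphi(\zeta_m^t w)$ as rational functions in the indeterminate $w$. Coordinates: for $\boldsymbol a=(a_0,\dots,a_d)$, $\boldsymbol b=(b_0,\dots,b_d)$, write $[\boldsymbol a,\boldsymbol b]=[a_0,\dots,a_d,b_0,\dots,b_d]\in\mathbb{P}^{2d+1}$ and $$\varphi_{\boldsymbol a,\boldsymbol b}(z)=\frac{a_0z^d+a_1z^{d-1}+\cdots+a_d}{b_0z^d+b_1z^{d-1}+\cdots+b_d}.$$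 The space $\mathrm{Rat}_d$ of rational functions of degree exactly $d$ is identified via $\varphi_{\boldsymbol a,\boldsymbol b}\leftrightarrow[\boldsymbol a,\boldsymbol b]$ with the affine open subset of $\mathbb{P}^{2d+1}$ (over $\mathbb{Z}$) where the resultant of numerator and denominator, viewed as homogeneous forms of degree $d$, is nonzero. The map $\mathfrak{R}_{d,m,0}:\mathbb{P}^{2d+1}_{\mathbb{Z}}\dashrightarrow\mathbb{P}^{2d+1}_{\mathbb{Z}}$ is the unique rational map such that for every field $K$ with $m\ne0$ in $K$ and every $\varphi_{\boldsymbol a,\boldsymbol b}\in\mathrm{Rat}_d(K)$ with $\deg_z\mathfrak{F}_{m,0}(\varphi_{\boldsymbol a,\boldsymbol b})=d$, the point $\mathfrak{R}_{d,m,0}([\boldsymbol a,\boldsymbol b])$ is the point corresponding to $\mathfrak{F}_{m,0}(\varphi_{\boldsymbol a,\boldsymbol b})$. The algebraic degree of a rational map $f:\mathbb{P}^N\dashrightarrow\mathbb{P}^N$ is the integer $e$ with $f^*\mathcal{O}_{\mathbb{P}^N}(1)=\mathcal{O}_{\mathbb{P}^N}(e)$, i.e. the common degree of homogeneous coordinate polynomials without nontrivial common factor defining $f$. *)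

(* Defs.v *)
From HB Require Import structures.
From mathcomp Require Import all_boot all_order all_algebra.
From mathcomp Require Export fraction.
From mathcomp Require Export mpoly.

Set Implicit Arguments.
Unset Strict Implicit.
Unset Printing Implicit Defensive.

Import GRing.Theory.
Local Open Scope ring_scope.

Local Notation "x %:F" := (@FracField.tofrac _ x) : ring_scope.

(** * Rational functions in one variable, as elements of [{fraction {poly K}}] *)

(* [ratfun_subst iota q f] is f(q) in L(w), for f in K(z) and q in L[w], where
   L is an extension of K through iota.  For non-constant q (the only case used
   below) the denominator does not vanish and the value does not depend on the
   chosen representative of f. *)
Definition ratfun_subst (K L : fieldType) (iota : {rmorphism K -> L})
    (q : {poly L}) (f : {fraction {poly K}}) : {fraction {poly L}} :=
  (map_poly iota \n_(repr f) \Po q)%:F / (map_poly iota \d_(repr f) \Po q)%:F.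

(* Degree of f as a self-map of the projective line: the maximum of the degrees
   of the numerator and denominator of f in lowest terms. *)
Definition ratfun_deg (K : fieldType) (f : {fraction {poly K}}) : nat :=
  let p := \n_(repr f) in
  let q := \d_(repr f) in
  (maxn (size (p %/ gcdp p q)) (size (q %/ gcdp p q))).-1.

(* psi is the (m,0)-Landen transform of phi: psi(w^m) is the average over t of
   phi(zeta^t w), for a primitive m-th root of unity zeta in an extension L. *)
Definition landen_transform (m : nat) (K : fieldType)
    (phi psi : {fraction {poly K}}) : Prop :=
  exists (L : fieldType) (iota : {rmorphism K -> L}) (zeta : L),
    m.-primitive_root zeta /\
    ratfun_subst iota 'X^m psi =
      m%:R^-1 * \sum_(t < m) ratfun_subst iota (zeta ^+ t *: 'X) phi.

(** * The parameter space of rational functions of degree d *)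

(* A point [a_0,...,a_d,b_0,...,b_d] of P^(2d+1)(K) is given by a nonzero row
   vector of length (d+1)+(d+1), considered up to scaling; its left half is a
   and its right half is b. *)
Notation ncoord d := (d.+1 + d.+1)%N.

(* a_0 z^d + a_1 z^(d-1) + ... + a_d *)
Definition form_poly (K : fieldType) (d : nat) (a : 'rV[K]_d.+1) : {poly K} :=
  \sum_(i < d.+1) a 0 i *: 'X^(d - i).

Definition phi_of (K : fieldType) (d : nat) (P : 'rV[K]_(ncoord d)) :
    {fraction {poly K}} :=
  (form_poly (lsubmx P))%:F / (form_poly (rsubmx P))%:F.

(* The resultant of two binary forms of degree d.  MathComp's [resultant] uses
   the actual degrees of its polynomial arguments, so it does not vanish
   when a_0 = b_0 = 0, whereas the resultant of forms must. *)
Definition sylvester_rows (K : fieldType) (d : nat) (a : 'rV[K]_d.+1) :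
    'M[K]_(d, d + d) :=
  \matrix_(i, j) (if (i <= j <= i + d)%N then a 0 (inord (j - i)) else 0).

Definition form_resultant (K : fieldType) (d : nat) (a b : 'rV[K]_d.+1) : K :=
  \det (col_mx (sylvester_rows a) (sylvester_rows b)).

Definition in_Rat (K : fieldType) (d : nat) (P : 'rV[K]_(ncoord d)) : Prop :=
  form_resultant (lsubmx P) (rsubmx P) != 0.

(** * Rational maps of projective space over the integers *)

(* Value of an integral polynomial at a K-valued point. *)
Definition mpeval (K : fieldType) (n : nat) (P : 'rV[K]_n)
    (p : {mpoly int[n]}) : K :=
  mmap intr (fun i => P 0 i) p.

Definition mpeval_tuple (K : fieldType) (n k : nat)
    (f : k.-tuple {mpoly int[n]}) (P : 'rV[K]_n) : 'rV[K]_k :=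
  \row_i mpeval P (tnth f i).

(* [ratmap n] consists of representatives of the rational self-maps of the
   projective space over Z with n homogeneous coordinates; since that scheme is
   integral, such a map is a tuple of n forms of the same degree over Z, not
   all zero, up to proportionality ([ratmap_eq]). *)
Record ratmap (n : nat) := RatMap {
  ratmap_coords :> n.-tuple {mpoly int[n]};
  ratmap_homog : exists e : nat, forall i, tnth ratmap_coords i \is e.-homog;
  ratmap_neq0 : exists i, tnth ratmap_coords i != 0 }.

Definition proportional (R : comNzRingType) (n : nat) (u v : n.-tuple R) :
    Prop :=
  forall i j, tnth u i * tnth v j = tnth u j * tnth v i.

Definition ratmap_eq (n : nat) (f g : ratmap n) : Prop := proportional f g.

(* f is defined at the K-point P, with value the K-point Q. *)
Definition ratmap_at (n : nat) (f : ratmap n) (K : fieldType)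
    (P Q : 'rV[K]_n) : Prop :=
  P != 0 /\
  exists g : ratmap n, [/\ ratmap_eq f g, mpeval_tuple g P != 0 &
    exists2 c : K, c != 0 & Q = c *: mpeval_tuple g P].

(* The composite of f after g is defined and equal to h. *)
Definition ratmap_comp (n : nat) (f g h : ratmap n) : Prop :=
  exists f' : ratmap n,
    let fg := [tuple tnth f' i \mPo g | i < n] in
    [/\ ratmap_eq f f', exists i, tnth fg i != 0 & proportional fg h].

Definition ratmap_commute (n : nat) (f g : ratmap n) : Prop :=
  exists h : ratmap n, ratmap_comp f g h /\ ratmap_comp g f h.

(* The image of f is Zariski dense: no nonzero form over Z vanishes on it. *)
Definition ratmap_dominant (n : nat) (f : ratmap n) : Prop :=
  forall (e : nat) (p : {mpoly int[n]}), p \is e.-homog ->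
    (forall (K : fieldType) (P Q : 'rV[K]_n),
       ratmap_at f P Q -> mpeval Q p = 0) ->
    p = 0.

Definition algebraic_degree (n : nat) (f : ratmap n) (e : nat) : Prop :=
  exists g : ratmap n, [/\ ratmap_eq f g,
    forall i, tnth g i \is e.-homog &
    forall c : {mpoly int[n]},
      (forall i, exists q, tnth g i = c * q) -> c \is a GRing.unit].

(* f is the rational map R_{d,m,0}: whenever phi_P has degree d and its Landen
   transform psi has degree d as well, f is defined at P and f(P) is the point
   corresponding to psi. *)
Definition is_landen_map (d m : nat) (f : ratmap (ncoord d)) : Prop :=
  forall (K : fieldType) (P : 'rV[K]_(ncoord d)) (psi : {fraction {poly K}}),
    m%:R != 0 :> K ->
    in_Rat P ->
    landen_transform m (phi_of P) psi ->
    ratfun_deg psi = d ->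
    exists Q : 'rV[K]_(ncoord d),
      [/\ in_Rat Q, phi_of Q = psi & ratmap_at f P Q].

(** * Polynomial endomorphisms of affine space over the integers *)

Notation polyendo N := (N.-tuple {mpoly int[N]}).

Definition polyendo_comp (N : nat) (f g : polyendo N) : polyendo N :=
  [tuple tnth f i \mPo g | i < N].

Definition polyendo_dominant (N : nat) (f : polyendo N) : Prop :=
  forall p : {mpoly int[N]},
    (forall (K : fieldType) (x : 'rV[K]_N), mpeval (mpeval_tuple f x) p = 0) ->
    p = 0.

(* The chart (a_0,...,a_d,b_1,...,b_d) |-> [a_0,...,a_d,1,b_1,...,b_d] from
   A^(2d+1) onto the locus b_0 <> 0. *)
Definition chart_b0 (d : nat) (K : fieldType) (x : 'rV[K]_(d.+1 + d)) :
    'rV[K]_(ncoord d) :=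
  row_mx (lsubmx x) (row_mx (const_mx 1 : 'rV[K]_1) (rsubmx x) : 'rV[K]_d.+1).

(* The chart (a_1,...,a_d,b_1,...,b_d) |-> [0,a_1,...,a_d,1,b_1,...,b_d] from
   A^(2d) onto the locus a_0 = 0, b_0 <> 0. *)
Definition chart_a0_b0 (d : nat) (K : fieldType) (x : 'rV[K]_(d + d)) :
    'rV[K]_(ncoord d) :=
  row_mx (row_mx (const_mx 0 : 'rV[K]_1) (lsubmx x) : 'rV[K]_d.+1)
         (row_mx (const_mx 1 : 'rV[K]_1) (rsubmx x) : 'rV[K]_d.+1).

(* Through the chart, f is everywhere defined, preserves the chart and is given
   there by the polynomial map h. *)
Definition induces (n N : nat) (chart : forall K : fieldType, 'rV[K]_N -> 'rV[K]_n)
    (f : ratmap n) (h : polyendo N) : Prop :=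
  forall (K : fieldType) (x : 'rV[K]_N),
    ratmap_at f (chart K x) (chart K (mpeval_tuple h x)).

(* The maps f_m (m >= 1) induce, through the chart, commuting dominant
   polynomial endomorphisms of A^N. *)
Definition induces_commuting_dominant (n N : nat)
    (chart : forall K : fieldType, 'rV[K]_N -> 'rV[K]_n)
    (f : nat -> ratmap n) : Prop :=
  exists h : nat -> polyendo N,
    [/\ forall m, (0 < m)%N -> induces chart (f m) (h m),
        forall m k, (0 < m)%N -> (0 < k)%N ->
          polyendo_comp (h m) (h k) = polyendo_comp (h k) (h m) &
        forall m, (0 < m)%N -> polyendo_dominant (h m)].

(* Main.v *)
Require Import Defs.
From HB Require Import structures.
From mathcomp Require Import all_boot all_order all_algebra.
From mathcomp Require Import all_field.
From mathcomp Require Import zify.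

(* Split p(w) = sum_(r < m) w^r p_r(w^m).  If q(w) acts on the free
   R[w^m]-module R[w] by the matrix M_q, then det M_q is the norm
   prod_t q(zeta^t w) and (M_p adj M_q)_00 / det M_q is the average of p/q over
   the rotations w |-> zeta^t w.  So the Landen transform is represented by two
   polynomials whose coefficients are integral forms of degree m in those of p
   and q.  All identities between such forms, and uniqueness, are checked at
   complex algebraic points outside a hypersurface; that the generic image has
   degree d is seen at 1 / (z - 1)^d.  The maps commute because averaging over
   n-th and then k-th roots of unity averages over nk-th roots.
   Dominance: given B = c prod (z - c_i) with c and all c_i nonzero, take
   q = root(c) prod (z - root(c_i)) for one fixed choice of m-th roots; q is
   coprime to its rotations, hence p |-> num(p, q) is injective on polynomials
   of degree at most d, hence bijective.  The degree is exactly m because the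
   coordinates include b_0^m and +-b_d^m. *)

Set Implicit Arguments.
Unset Strict Implicit.
Unset Printing Implicit Defensive.

Import Order.TTheory GRing.Theory Num.Theory.
Local Open Scope ring_scope.

Local Notation "x %:F" := (@FracField.tofrac _ x) : ring_scope.

(** The average divides by m and uses roots of unity, whereas the maps must be given over Z and, on
    the charts, evaluated in fields where m = 0. Averaging over the rotations is the projection of
    R[w] onto its component R[w^m]; this projection exists over every ring and involves no division,
    so that a matrix entry can replace the average. A second obstacle is that a rational map is only
    a class of proportional tuples. Norm and numerator are therefore computed exactly, signs and
    scalars included: composites then agree as tuples of polynomials, and the maps induced on the
    charts commute on the nose. Wherever a transform is involved, [n] (likewise [k] and [N]) stands
    for m - 1, which makes the matrices of size m nonempty. *)

Lemma big_ord_mul (R : Type) (idx : R) (op : Monoid.com_law idx) a b (F : nat -> R) :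
  \big[op/idx]_(i < a * b) F i =
  \big[op/idx]_(t < b) \big[op/idx]_(s < a) F (s * b + t)%N.
Proof.
rewrite -(big_mkord xpredT F) big_nat_mul big_mkord exchange_big /=.
apply: eq_bigr => s _; rewrite -{1}[(s * b)%N]add0n big_addn mulSn addnK.
by rewrite big_mkord; apply: eq_bigr => t _; rewrite addnC.
Qed.

(** * The norm of the denominator and the averaged numerator *)

(** The component p_r of the splitting, for m = [n.+1]. The bound [size p] is crude: the
    coefficients beyond it vanish. *)
Definition poly_section (R : nzRingType) (n r : nat) (p : {poly R}) : {poly R} :=
  \poly_(k < size p) p`_(k * n.+1 + r).

Lemma coef_poly_section (R : nzRingType) (n r : nat) (p : {poly R}) k :
  (poly_section n r p)`_k = p`_(k * n.+1 + r).
Proof.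
rewrite coef_poly; case: ltnP => // le_k; rewrite nth_default //.
by rewrite (leq_trans le_k) // (leq_trans (leq_pmulr k (ltn0Sn n))) ?leq_addr.
Qed.

Lemma poly_section_is_linear (R : comNzRingType) (n r : nat) (c : R) p q :
  poly_section n r (c *: p + q) = c *: poly_section n r p + poly_section n r q.
Proof. by apply/polyP => k; rewrite !(coefD, coefZ, coef_poly_section). Qed.

Lemma map_poly_section (R S : nzRingType) (f : {rmorphism R -> S}) n r p :
  map_poly f (poly_section n r p) = poly_section n r (map_poly f p).
Proof. by apply/polyP => k; rewrite !(coef_map, coef_poly_section). Qed.

Lemma horner_poly_section (R : comNzRingType) n (p : {poly R}) y :
  p.[y] = \sum_(r < n.+1) (poly_section n r p).[y ^+ n.+1] * y ^+ r.
Proof.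
rewrite (@horner_coef_wide _ (size p * n.+1)) ?leq_pmulr //.
rewrite (big_ord_mul _ _ _ (fun i => p`_i * y ^+ i)); apply: eq_bigr => r _ /=.
rewrite (@horner_coef_wide _ (size p)) ?size_poly // mulr_suml.
by apply: eq_bigr => k _; rewrite coef_poly_section exprD mulnC exprM mulrA.
Qed.

(* Multiplication by q(w) on R[w], in the basis 1, w, ..., w^n of R[w] over
   R[w^(n+1)]. *)
Definition mulmx_of (R : comNzRingType) (n : nat) (q : {poly R}) :
    'M[{poly R}]_n.+1 :=
  \matrix_(i, j) poly_section n i (q * 'X^j).

Definition landen_den (R : comNzRingType) n (q : {poly R}) : {poly R} :=
  \det (mulmx_of n q).

(** Column 0 of the product lists the components of p(w) N(q) / q(w), with N(q) the norm of q; row 0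
    selects the component in R[w^m], which is the average over the rotations. *)
Definition landen_num (R : comNzRingType) n (p q : {poly R}) : {poly R} :=
  (mulmx_of n p *m \adj (mulmx_of n q)) 0 0.

Lemma map_mulmx_of (R S : comNzRingType) (f : {rmorphism R -> S}) n q :
  map_mx (map_poly f) (mulmx_of n q) = mulmx_of n (map_poly f q).
Proof.
apply/matrixP => i j; rewrite !mxE map_poly_section rmorphM /= map_polyXn.
by [].
Qed.

Lemma map_landen_den (R S : comNzRingType) (f : {rmorphism R -> S}) n q :
  map_poly f (landen_den n q) = landen_den n (map_poly f q).
Proof. by rewrite /landen_den -det_map_mx map_mulmx_of. Qed.

Lemma map_landen_num (R S : comNzRingType) (f : {rmorphism R -> S}) n p q :
  map_poly f (landen_num n p q) = landen_num n (map_poly f p) (map_poly f q).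
Proof.
by rewrite /landen_num -!map_mulmx_of -map_mx_adj -map_mxM [RHS]mxE.
Qed.

Lemma landen_num_is_linear (R : comNzRingType) n (c : R) (p1 p2 q : {poly R}) :
  landen_num n (c *: p1 + p2) q = c *: landen_num n p1 q + landen_num n p2 q.
Proof.
rewrite /landen_num; suff ->: mulmx_of n (c *: p1 + p2) =
  c%:P *: mulmx_of n p1 + mulmx_of n p2.
  by rewrite mulmxDl -scalemxAl !mxE mul_polyC.
apply/matrixP => i j; rewrite !mxE mulrDl -scalerAl poly_section_is_linear.
by rewrite mul_polyC.
Qed.

Lemma landen_numZ (R : comNzRingType) n (c : R) (p q : {poly R}) :
  landen_num n (c *: p) q = c *: landen_num n p q.
Proof.
have num0: landen_num n 0 q = 0.
  have := landen_num_is_linear n 1 0 0 q; rewrite !scale1r addr0 => /eqP.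
  by rewrite -{1}[landen_num n 0 q]addr0 (inj_eq (addrI _)) eq_sym => /eqP.
by rewrite -[c *: p]addr0 landen_num_is_linear num0 addr0.
Qed.

Lemma landen_num_diag (R : comNzRingType) n (q : {poly R}) :
  landen_num n q q = landen_den n q.
Proof. by rewrite /landen_num mul_mx_adj !mxE eqxx mulr1n. Qed.

Lemma horner_mulmx_of (R : comNzRingType) n (q : {poly R}) (y : R) (j : 'I_n.+1) :
  \sum_(i < n.+1) y ^+ i * (mulmx_of n q i j).[y ^+ n.+1] = q.[y] * y ^+ j.
Proof.
transitivity (q * 'X^j).[y]; last by rewrite hornerM hornerXn.
by rewrite (horner_poly_section n); apply: eq_bigr => i _; rewrite mxE mulrC.
Qed.

(** * Diagonalization at a point by roots of unity *)

Section Evaluation.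

Variables (E : fieldType) (n : nat) (zeta : E).
Hypothesis prim_zeta : n.+1.-primitive_root zeta.
Implicit Types (x : E) (p q : {poly E}).

Local Notation ev y := (map_mx (horner_eval y)).

(** The transposed Vandermonde matrix of the points zeta^t x. Row t evaluates the basis 1, w, ...,
    w^n at zeta^t x, so it is a left eigenvector of every specialized multiplication matrix, with
    eigenvalue q(zeta^t x). *)
Let powmx x : 'M[E]_n.+1 := \matrix_(t, i) (zeta ^+ t * x) ^+ i.

Let zetaXn x (t : nat) : (zeta ^+ t * x) ^+ n.+1 = x ^+ n.+1.
Proof. by rewrite exprMn exprAC (prim_expr_order prim_zeta) expr1n mul1r. Qed.

Let det_powmx x : x != 0 -> \det (powmx x) != 0.
Proof.
move=> x0; pose a : 'rV[E]_n.+1 := \row_t (zeta ^+ t * x).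
have ->: powmx x = (Vandermonde n.+1 a)^T by apply/matrixP=> t i; rewrite !mxE.
rewrite det_tr det_Vandermonde prodf_seq_neq0; apply/allP => i _ /=.
rewrite prodf_seq_neq0; apply/allP => j _ /=; apply/implyP => ij.
rewrite !mxE subr_eq0 (inj_eq (mulIf x0)) (eq_prim_root_expr prim_zeta).
by rewrite !modn_small // eq_sym neq_ltn ij.
Qed.

Let powmx_mul x q : powmx x *m ev (x ^+ n.+1) (mulmx_of n q) =
  diag_mx (\row_t q.[zeta ^+ t * x]) *m powmx x.
Proof.
apply/matrixP => t j; rewrite mul_diag_mx !mxE -horner_mulmx_of zetaXn.
by apply: eq_bigr => i _; rewrite !mxE.
Qed.

Let ev_den x q : (landen_den n q).[x ^+ n.+1] = \det (ev (x ^+ n.+1) (mulmx_of n q)).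
Proof. by rewrite -[LHS]/(horner_eval _ _) /landen_den -det_map_mx. Qed.

(** Determinants of both sides of [powmx_mul]; the Vandermonde factor cancels because [x != 0]. *)
Lemma horner_landen_den x q : x != 0 ->
  (landen_den n q).[x ^+ n.+1] = \prod_(t < n.+1) q.[zeta ^+ t * x].
Proof.
move=> x0; apply/(mulfI (det_powmx x0)); rewrite ev_den -det_mulmx powmx_mul.
rewrite det_mulmx det_diag mulrC; congr (_ * _).
by apply: eq_bigr => t _; rewrite mxE.
Qed.

(** The row vector [n.+1%:R *: delta_mx 0 0] is the sum of the eigenvectors [row t (powmx x)], since
    the sums of powers of zeta vanish in every other column. Entry (0,0) thus splits into one
    eigenvalue product for each t. *)
Lemma horner_landen_num x p q : x != 0 ->
    (forall t : 'I_n.+1, q.[zeta ^+ t * x] != 0) ->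
  n.+1%:R * (landen_num n p q).[x ^+ n.+1] =
  \sum_(t < n.+1) p.[zeta ^+ t * x] * \prod_(s < n.+1 | s != t) q.[zeta ^+ s * x].
Proof.
move=> x0 q0; set z := x ^+ n.+1.
have numE: (landen_num n p q).[z] =
    (ev z (mulmx_of n p) *m \adj (ev z (mulmx_of n q))) 0 0.
  by rewrite -[LHS]/(horner_eval _ _) /landen_num -map_mx_adj -map_mxM [RHS]mxE.
have sum_powmx: n.+1%:R *: delta_mx 0 0 = \sum_t row t (powmx x) :> 'rV[E]_n.+1.
  apply/rowP => j; rewrite summxE !mxE /=.
  under eq_bigr => t _ do rewrite !mxE exprMn exprAC.
  have [->|j0] := eqVneq j 0.
    rewrite !mulr1; under eq_bigr => t _ do rewrite !expr0 expr1n mulr1.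
    by rewrite sumr_const card_ord.
  rewrite mulr0 -mulr_suml; suff ->: \sum_(t < n.+1) (zeta ^+ j) ^+ t = 0 by rewrite mul0r.
  apply: (@mulfI _ (zeta ^+ j - 1)).
    rewrite subr_eq0 -(expr0 zeta) (eq_prim_root_expr prim_zeta) mod0n modn_small //.
  by rewrite mulr0 -subrX1 exprAC (prim_expr_order prim_zeta) expr1n subrr.
have row_powmx q' t : row t (powmx x) *m ev z (mulmx_of n q') =
    q'.[zeta ^+ t * x] *: row t (powmx x).
  rewrite -row_mul powmx_mul; apply/rowP => j.
  by rewrite mxE mul_diag_mx !mxE.
(* The adjugate acts on an eigenvector by the determinant divided by the eigenvalue, that is, by the
   product of the other eigenvalues. *)
have row_adj t : row t (powmx x) *m \adj (ev z (mulmx_of n q)) =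
    (\prod_(s < n.+1 | s != t) q.[zeta ^+ s * x]) *: row t (powmx x).
  have: q.[zeta ^+ t * x] *: (row t (powmx x) *m \adj (ev z (mulmx_of n q))) =
      (\prod_(s < n.+1) q.[zeta ^+ s * x]) *: row t (powmx x).
    rewrite scalemxAl -row_powmx -mulmxA mul_mx_adj mul_mx_scalar.
    by rewrite -ev_den horner_landen_den.
  rewrite (bigD1 t) //= -scalerA => /(congr1 (fun v => (q.[zeta ^+ t * x])^-1 *: v)).
  by rewrite !scalerA !mulrA mulVf // mul1r scale1r.
rewrite numE.
transitivity ((n.+1%:R *: delta_mx 0 0 *m (ev z (mulmx_of n p) *m
   \adj (ev z (mulmx_of n q)))) (0 : 'I_1) 0).
  by rewrite -scalemxAl -rowE !mxE.
rewrite sum_powmx mulmx_suml summxE; apply: eq_bigr => t _.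
by rewrite mulmxA row_powmx -scalemxAl row_adj scalerA !mxE expr0 mulr1.
Qed.

Lemma landen_average x p q : x != 0 ->
    (forall t : 'I_n.+1, q.[zeta ^+ t * x] != 0) ->
  (landen_num n p q).[x ^+ n.+1] / (landen_den n q).[x ^+ n.+1] =
  n.+1%:R^-1 * \sum_(t < n.+1) p.[zeta ^+ t * x] / q.[zeta ^+ t * x].
Proof.
move=> x0 q0; have n0 : n.+1%:R != 0 :> E by rewrite (prim_root_natf_neq0 prim_zeta).
rewrite horner_landen_den // -[X in X / _](mulKf n0) horner_landen_num //.
rewrite -mulrA mulr_suml; congr (_ * _); apply: eq_bigr => t _.
have P0 : \prod_(s < n.+1 | s != t) q.[zeta ^+ s * x] != 0.
  by rewrite prodf_seq_neq0; apply/allP=> s _; apply/implyP.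
by rewrite [X in _ / X](bigD1 t) //= -mulf_div divff // mulr1.
Qed.

End Evaluation.

(** * Polynomial identities at the generic point *)

(** Over the field L(w) the indeterminate is a point at which no nonzero polynomial over L vanishes.
    Evaluating there turns the pointwise formulas into polynomial identities, even when L is
    finite. *)
Definition gen_const (L : fieldType) : {rmorphism L -> {fraction {poly L}}} :=
  (@FracField.tofrac {poly L}) \o polyC.

Lemma horner_gen_const (L : fieldType) (p q : {poly L}) :
  (map_poly (gen_const L) p).[q%:F] = (p \Po q)%:F.
Proof. by rewrite map_poly_comp horner_map. Qed.

Lemma comp_scaleX_eq0 (L : fieldType) (c : L) (p : {poly L}) :
  c != 0 -> (p \Po (c *: 'X) == 0) = (p == 0).
Proof. by move=> c0; rewrite comp_poly2_eq0 // size_scale // size_polyX. Qed.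

Lemma comp_Xn_inj (L : fieldType) n : injective (fun p : {poly L} => p \Po 'X^(n.+1)).
Proof.
move=> p q /eqP; rewrite -subr_eq0 -comp_polyB comp_poly_eq0 ?size_polyXn //.
by rewrite subr_eq0 => /eqP.
Qed.

Lemma prim_root_neq0 (L : fieldType) n (zeta : L) :
  n.+1.-primitive_root zeta -> zeta != 0.
Proof. by move=> pz; rewrite (prim_root_eq0 pz). Qed.

Lemma prim_root_exp_factor (L : fieldType) n k N (zeta : L) :
    N.+1 = (k.+1 * n.+1)%N -> N.+1.-primitive_root zeta ->
  n.+1.-primitive_root (zeta ^+ k.+1).
Proof.
move=> NE pz; have := dvdn_prim_root pz (_ : n.+1 %| N.+1)%N.
by rewrite NE mulnK // => -> //; apply: dvdn_mull.
Qed.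

Section GenericPoint.

Variables (L : fieldType) (n : nat) (zeta : L).
Hypothesis prim_zeta : n.+1.-primitive_root zeta.
Implicit Types p q : {poly L}.

Local Notation gen := (map_poly (gen_const L)).

Let X0 : 'X%:F != 0 :> {fraction {poly L}}.
Proof. by rewrite tofrac_eq0 polyX_eq0. Qed.

Let pgen : n.+1.-primitive_root (gen_const L zeta).
Proof. by rewrite fmorph_primitive_root. Qed.

Let horner_gen q (t : nat) :
  (gen q).[gen_const L zeta ^+ t * 'X%:F] = (q \Po (zeta ^+ t *: 'X))%:F.
Proof.
rewrite -rmorphXn -[X in X * _]/((zeta ^+ t)%:P%:F) -tofracM mul_polyC.
exact: horner_gen_const.
Qed.

Let horner_gen0 q (t : 'I_n.+1) : q != 0 ->
  (gen q).[gen_const L zeta ^+ t * 'X%:F] != 0.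
Proof.
move=> q0; rewrite horner_gen tofrac_eq0 comp_scaleX_eq0 //.
exact: expf_neq0 (prim_root_neq0 prim_zeta).
Qed.

Lemma landen_den_comp q :
  landen_den n q \Po 'X^(n.+1) = \prod_(t < n.+1) (q \Po (zeta ^+ t *: 'X)).
Proof.
apply/eqP; rewrite -tofrac_eq -horner_gen_const map_landen_den tofracXn.
rewrite (horner_landen_den pgen _ X0) rmorph_prod; apply/eqP/eq_bigr => t _.
exact: horner_gen.
Qed.

Lemma landen_num_comp p q : q != 0 ->
  n.+1%:R *: (landen_num n p q \Po 'X^(n.+1)) =
  \sum_(t < n.+1) (p \Po (zeta ^+ t *: 'X)) *
    \prod_(s < n.+1 | s != t) (q \Po (zeta ^+ s *: 'X)).
Proof.
move=> q0; apply/eqP; rewrite -tofrac_eq -mul_polyC.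
rewrite tofracM rmorph_nat tofracMn tofrac1.
rewrite -horner_gen_const map_landen_num tofracXn.
rewrite (horner_landen_num pgen _ X0 (fun t => horner_gen0 t q0)).
rewrite rmorph_sum; apply/eqP/eq_bigr => t _; rewrite rmorphM /= horner_gen.
by rewrite rmorph_prod; congr (_ * _); apply: eq_bigr => s _; rewrite horner_gen.
Qed.

Lemma landen_den_eq0 q : (landen_den n q == 0) = (q == 0).
Proof.
rewrite -(@comp_poly_eq0 _ _ 'X^(n.+1)) ?size_polyXn // landen_den_comp.
apply/idP/eqP => [|->]; last by rewrite big_ord_recl comp_poly0 mul0r.
apply: contraTeq => q0; rewrite prodf_seq_neq0; apply/allP => t _ /=.
by rewrite comp_scaleX_eq0 // expf_neq0 // (prim_root_neq0 prim_zeta).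
Qed.

Lemma landen_comp_frac p q : q != 0 ->
  (landen_num n p q \Po 'X^(n.+1))%:F / (landen_den n q \Po 'X^(n.+1))%:F =
  n.+1%:R^-1 * \sum_(t < n.+1)
    (p \Po (zeta ^+ t *: 'X))%:F / (q \Po (zeta ^+ t *: 'X))%:F.
Proof.
move=> q0; have := landen_average pgen (gen p) X0 (fun t => horner_gen0 t q0).
rewrite -map_landen_num -map_landen_den -tofracXn !horner_gen_const => ->.
by congr (_ * _); apply: eq_bigr => t _; rewrite !horner_gen.
Qed.

Let size_comp_scale q t : size (q \Po (zeta ^+ t *: 'X)) = size q.
Proof.
rewrite size_comp_poly2 // size_scale ?size_polyX //.
exact: expf_neq0 (prim_root_neq0 prim_zeta).
Qed.

Let size_comp_Xn q : (size (q \Po 'X^(n.+1))).-1 = ((size q).-1 * n.+1)%N.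
Proof. by rewrite size_comp_poly size_polyXn. Qed.

Lemma size_landen_den q : size (landen_den n q) = size q.
Proof.
have [->|q0] := eqVneq q 0.
  by apply/eqP; rewrite size_poly0 size_poly_eq0 landen_den_eq0.
have D0 : landen_den n q != 0 by rewrite landen_den_eq0.
suff: (size (landen_den n q)).-1 = (size q).-1.
  move=> h; rewrite -(prednK (_ : 0 < size q)%N) ?lt0n ?size_poly_eq0 // -h.
  by rewrite prednK ?lt0n ?size_poly_eq0.
apply/eqP; rewrite -(eqn_pmul2r (ltn0Sn n)) -[X in X == _]size_comp_Xn.
rewrite landen_den_comp.
rewrite size_prod => [|t _]; last first.
  by rewrite comp_scaleX_eq0 // expf_neq0 // (prim_root_neq0 prim_zeta).
under eq_bigr => t _ do rewrite size_comp_scale.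
rewrite sum_nat_const card_ord -{1}(prednK (_ : 0 < size q)%N) ?lt0n ?size_poly_eq0 //=.
by rewrite mulnS -addnS addKn mulnC.
Qed.

(** Each summand in [landen_num_comp] has one factor of degree at most [e] and [n] factors of degree
    at most [d], while substituting X^(n+1) multiplies degrees by n+1. The cases e = d and e = d - 1
    are the ones applied. *)
Lemma leq_size_landen_num p q d e : q != 0 ->
  (size p <= e.+1)%N -> (size q <= d.+1)%N -> 
  ((size (landen_num n p q)).-1 * n.+1 <= e + n * d)%N.
Proof.
move=> q0 sp sq; rewrite -size_comp_Xn.
have n0 : n.+1%:R != 0 :> L by rewrite (prim_root_natf_neq0 prim_zeta).
rewrite -(size_scale _ n0) landen_num_comp // -subn1 leq_subLR add1n.
apply: leq_trans (size_sum _ _ _) _; apply/bigmax_leqP => t _.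
apply: leq_trans (size_mul_leq _ _) _; rewrite size_comp_scale.
have: (size (\prod_(s < n.+1 | s != t) (q \Po (zeta ^+ s *: 'X)))%R <= (n * d).+1)%N.
  apply: leq_trans (size_poly_prod_leq _ _) _.
  rewrite (eq_bigr (fun=> size q)) => [|s _]; last exact: size_comp_scale.
  rewrite sum_nat_const [#|_|](_ : _ = n); last first.
    by have := cardC1 t; rewrite card_ord.
  rewrite leq_subLR addnS ltnS -mulnS leq_mul2l sq orbT //.
move=> /(leq_add sp); rewrite addSn addnS => h.
by rewrite -subn1 leq_subLR (leq_trans h).
Qed.

Lemma size_landen_num p q d : q != 0 ->
  (size p <= d.+1)%N -> (size q <= d.+1)%N -> (size (landen_num n p q) <= d.+1)%N.
Proof.
move=> q0 sp sq; have := leq_size_landen_num q0 sp sq.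
rewrite -mulSn mulnC leq_pmul2l // -ltnS => h; exact: leq_trans (leqSpred _) h.
Qed.

Lemma size_landen_num_lt p q d : q != 0 ->
  (size p <= d)%N -> (size q <= d.+1)%N -> (size (landen_num n p q) <= d)%N.
Proof.
case: d => [|d] q0 sp sq.
  have/eqP-> : p == 0 by rewrite -size_poly_leq0.
  by rewrite -(scale0r 0) landen_numZ scale0r size_poly0.
have := leq_size_landen_num q0 sp sq.
move=> h; apply: leq_trans (leqSpred _) _; rewrite -(ltn_pmul2r (ltn0Sn n)).
by rewrite (leq_ltn_trans h) // [X in (_ < X)%N]mulnC mulSn addSn ltnS.
Qed.

End GenericPoint.

(** * Leading coefficient, roots and multiplicativity of the norm *)

(** Constant terms in the factorization of X^(n+1) - 1. This product is the origin of the signs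
    [(-1) ^+ (n * d)]. *)
Lemma prod_prim_root (L : fieldType) n (zeta : L) :
  n.+1.-primitive_root zeta -> \prod_(t < n.+1) zeta ^+ t = (-1) ^+ n.
Proof.
move=> pz; have := congr1 (horner^~ 0) (factor_Xn_sub_1 pz).
rewrite big_mkord horner_prod hornerD hornerN hornerXn hornerC expr0n /= add0r.
under eq_bigr => t _ do rewrite hornerXsubC sub0r.
rewrite prodrN card_ord exprS mulN1r mulNr => /oppr_inj h.
by rewrite -[LHS](signrMK n) h mulr1.
Qed.

Lemma poly2_root (L : fieldType) (p : {poly L}) a : size p = 2%N -> root p a ->
  p = lead_coef p *: ('X - a%:P).
Proof.
move=> sp /factor_theorem[q pE]; have p0 : p != 0 by rewrite -size_poly_eq0 sp.
have q0 : q != 0 by apply: contraNneq p0 => q0; rewrite pE q0 mul0r.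
have /eqP/size_poly1P[c c0 qE] : size q = 1%N.
  by move: sp; rewrite pE size_Mmonic ?monicXsubC // size_XsubC addn2 => -[].
by rewrite pE lead_coef_Mmonic ?monicXsubC // qE lead_coefC mul_polyC.
Qed.

Section Multiplicativity.

Variables (L : fieldType) (n : nat) (zeta : L).
Hypothesis prim_zeta : n.+1.-primitive_root zeta.
Implicit Types p q : {poly L}.

Lemma lead_coef_landen_den q :
  lead_coef (landen_den n q) = (-1) ^+ (n * (size q).-1) * lead_coef q ^+ n.+1.
Proof.
have <- : lead_coef (landen_den n q \Po 'X^(n.+1)) = lead_coef (landen_den n q).
  by rewrite lead_coef_comp ?size_polyXn // lead_coefXn expr1n mulr1.
rewrite (landen_den_comp prim_zeta) lead_coef_prod.
have zt0 t : zeta ^+ t != 0 by rewrite expf_neq0 // (prim_root_neq0 prim_zeta).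
under eq_bigr => t _.
  rewrite lead_coef_comp ?size_scale ?size_polyX // lead_coefZ lead_coefX mulr1.
  over.
rewrite big_split /= prodr_const card_ord mulrC; congr (_ * _).
by rewrite exprM -(prod_prim_root prim_zeta) prodrXl.
Qed.

Lemma landen_denM p q : landen_den n (p * q) = landen_den n p * landen_den n q.
Proof.
apply: (@comp_Xn_inj _ n); rewrite comp_polyM !(landen_den_comp prim_zeta).
by rewrite -big_split; apply: eq_bigr => t _; rewrite comp_polyM.
Qed.

Lemma landen_denC (c : L) : landen_den n c%:P = (c ^+ n.+1)%:P.
Proof.
apply: (@comp_Xn_inj _ n); rewrite (landen_den_comp prim_zeta) comp_polyC.
under eq_bigr => t _ do rewrite comp_polyC.
by rewrite prodr_const card_ord polyC_exp.
Qed.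

(** Read off the polynomial identity rather than the Vandermonde matrix, so the point 0 is included;
    the constant term of the norm comes from there. *)
Lemma horner_landen_den_Xn q x :
  (landen_den n q).[x ^+ n.+1] = \prod_(t < n.+1) q.[zeta ^+ t * x].
Proof.
have := congr1 (horner^~ x) (landen_den_comp prim_zeta q).
rewrite horner_comp hornerXn => ->; rewrite horner_prod.
by apply: eq_bigr => t _; rewrite horner_comp hornerZ hornerX.
Qed.

Lemma landen_den_at0 q : (landen_den n q).[0] = q.[0] ^+ n.+1.
Proof.
have := horner_landen_den_Xn q 0; rewrite expr0n => ->.
by under eq_bigr => t _ do rewrite mulr0; rewrite prodr_const card_ord.
Qed.

(** The norm has degree one and vanishes at y^(n+1). Norms thus raise roots to the power n+1, so
    prescribed roots are reached by extracting roots. *)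
Lemma landen_den_XsubC y :
  landen_den n ('X - y%:P : {poly L}) = (-1) ^+ n *: ('X - (y ^+ n.+1)%:P).
Proof.
rewrite {1}(@poly2_root _ (landen_den n ('X - y%:P)) (y ^+ n.+1)).
- by rewrite lead_coef_landen_den size_XsubC muln1 lead_coefXsubC expr1n mulr1.
- by rewrite (size_landen_den prim_zeta) size_XsubC.
- rewrite /root horner_landen_den_Xn big_ord_recl expr0 mul1r hornerXsubC subrr.
  by rewrite mul0r.
Qed.

Lemma landen_den_prod (r : seq L) : landen_den n (\prod_(y <- r) ('X - y%:P)) =
  (-1) ^+ (n * size r) *: \prod_(y <- r) ('X - (y ^+ n.+1)%:P).
Proof.
elim: r => [|y r IH]; first by rewrite !big_nil muln0 expr0 scale1r landen_denC expr1n.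
rewrite !big_cons landen_denM landen_den_XsubC IH -scalerAl -scalerAr scalerA.
by rewrite -exprD -mulnS.
Qed.

End Multiplicativity.

(** * Averaging in two stages *)

Section Composition.

Variables (L : fieldType) (n k N : nat) (zeta : L).
Hypothesis NE : N.+1 = (k.+1 * n.+1)%N.
Hypothesis prim_zeta : N.+1.-primitive_root zeta.
Implicit Types p q : {poly L}.

Let prim_n : n.+1.-primitive_root (zeta ^+ k.+1).
Proof. exact: prim_root_exp_factor NE prim_zeta. Qed.

Let prim_k : k.+1.-primitive_root (zeta ^+ n.+1).
Proof. by apply: prim_root_exp_factor prim_zeta; rewrite NE mulnC. Qed.

(** Rotating w by zeta^t rotates w^(k+1) by (zeta^(k+1))^t. The outer rotations t < n+1, followed by
    the inner ones by powers of zeta^(n+1), run over all zeta^(s(n+1)+t), hence over all rotations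
    for N. *)
Lemma landen_den_den q : landen_den n (landen_den k q) = landen_den N q.
Proof.
apply: (@comp_Xn_inj _ N); rewrite (landen_den_comp prim_zeta).
rewrite NE (big_ord_mul _ k.+1 n.+1 (fun i => q \Po (zeta ^+ i *: 'X))).
rewrite exprM -[X in _ \Po X](comp_Xn_poly 'X^(k.+1)) comp_polyA.
rewrite (landen_den_comp prim_n) rmorph_prod; apply: eq_bigr => t _ /=.
rewrite -comp_polyA comp_polyZ comp_polyX -exprM mulnC exprM -exprZn.
rewrite -(comp_Xn_poly (_ *: 'X)) comp_polyA (landen_den_comp prim_k) rmorph_prod.
apply: eq_bigr => s _ /=; rewrite -comp_polyA comp_polyZ comp_polyX scalerA.
by rewrite -exprM -exprD mulnC.
Qed.

(** By [landen_den_den] both numerators belong to the same denominator, and the two quotients are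
    one average, summed in two ways; the denominator then cancels. *)
Lemma landen_average_comp x p q : x != 0 ->
    (forall t : nat, q.[zeta ^+ t * x] != 0) ->
  (landen_num n (landen_num k p q) (landen_den k q)).[x ^+ N.+1] =
  (landen_num N p q).[x ^+ N.+1].
Proof.
move=> x0 q0.
have zx0 i : zeta ^+ i * x != 0 := mulf_neq0 (expf_neq0 i (prim_root_neq0 prim_zeta)) x0.
have q0' i (s : nat) : q.[(zeta ^+ n.+1) ^+ s * (zeta ^+ i * x)] != 0.
  by rewrite -exprM mulrA -exprD q0.
have avg_k i := landen_average prim_k p (zx0 i) (fun s => q0' i s).
have D0 i : (landen_den k q).[(zeta ^+ i * x) ^+ k.+1] != 0.
  rewrite (horner_landen_den prim_k _ (zx0 i)) prodf_seq_neq0; apply/allP => s _.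
  exact: q0'.
have xE i : (zeta ^+ k.+1) ^+ i * x ^+ k.+1 = (zeta ^+ i * x) ^+ k.+1.
  by rewrite exprMn exprAC.
have D0' (t : 'I_n.+1) : (landen_den k q).[(zeta ^+ k.+1) ^+ t * x ^+ k.+1] != 0.
  by rewrite xE; exact: D0.
have := landen_average prim_n (landen_num k p q) (expf_neq0 k.+1 x0) D0'.
rewrite -exprM -NE landen_den_den.
under eq_bigr => t _ do rewrite xE avg_k.
rewrite -mulr_sumr mulrA -invfM -natrM mulnC -NE.
have := landen_average prim_zeta p x0 (fun t => q0 t).
have -> : \sum_(t < N.+1) p.[zeta ^+ t * x] / q.[zeta ^+ t * x] =
    \sum_(t < n.+1) \sum_(s < k.+1) p.[(zeta ^+ n.+1) ^+ s * (zeta ^+ t * x)] /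
      q.[(zeta ^+ n.+1) ^+ s * (zeta ^+ t * x)].
  rewrite NE (big_ord_mul _ k.+1 n.+1 (fun i => p.[zeta ^+ i * x] / q.[zeta ^+ i * x])).
  apply: eq_bigr => t _; apply: eq_bigr => s _.
  by rewrite mulrA -exprM -exprD mulnC.
move=> <-; apply: mulIf; rewrite invr_eq0 (horner_landen_den prim_zeta) //.
by rewrite prodf_seq_neq0; apply/allP => t _ /=; exact: q0.
Qed.

End Composition.

Lemma landen_num_num (L : fieldType) n k N (zeta : L) (p q : {poly L}) :
    N.+1 = (k.+1 * n.+1)%N -> N.+1.-primitive_root zeta -> q != 0 ->
  landen_num n (landen_num k p q) (landen_den k q) = landen_num N p q.
Proof.
move=> NE pz q0.
have pZ : N.+1.-primitive_root (gen_const L zeta) by rewrite fmorph_primitive_root.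
have X0 : 'X%:F != 0 :> {fraction {poly L}} by rewrite tofrac_eq0 polyX_eq0.
have gq0 (i : nat) : (map_poly (gen_const L) q).[gen_const L zeta ^+ i * 'X%:F] != 0.
  rewrite -rmorphXn -[_ * 'X%:F]/((zeta ^+ i)%:P%:F * _) -tofracM horner_gen_const.
  rewrite mul_polyC tofrac_eq0 comp_scaleX_eq0 //.
  exact: expf_neq0 (prim_root_neq0 pz).
have := landen_average_comp NE pZ (map_poly (gen_const L) p) X0 gq0.
rewrite -map_landen_den -!map_landen_num -tofracXn !horner_gen_const => /eqP.
by rewrite tofrac_eq => /eqP/comp_Xn_inj.
Qed.

(** * Surjectivity onto a given numerator and denominator *)

Definition landen_numr (R : comNzRingType) n (q p : {poly R}) := landen_num n p q.

HB.instance Definition _ (R : comNzRingType) n (q : {poly R}) :=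
  GRing.isLinear.Build R {poly R} {poly R} _ (landen_numr n q)
    (fun c p1 p2 => landen_num_is_linear n c p1 p2 q).

Section LinearPart.

Variables (L : fieldType) (n : nat) (zeta : L).
Hypothesis prim_zeta : n.+1.-primitive_root zeta.
Variable q : {poly L}.
Hypothesis q0 : q != 0.
Hypothesis copr_q :
  forall t : 'I_n.+1, t != 0 -> coprimep q (q \Po (zeta ^+ t *: 'X)).

(** Every summand of [landen_num_comp] except the one for t = 0 contains q. If the total vanishes, q
    divides p times its own other rotations, hence p; by size p is a multiple c q, whose numerator
    is c times the nonzero norm. *)
Lemma landen_num_inj (p : {poly L}) :
  (size p <= size q)%N -> landen_num n p q = 0 -> p = 0.
Proof.
move=> le_pq num0; have := landen_num_comp prim_zeta p q0.
have q_id : q \Po (zeta ^+ (ord0 : 'I_n.+1) *: 'X) = q.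
  by rewrite expr0 scale1r comp_polyXr.
rewrite num0 comp_poly0 scaler0 (bigD1 0) //= expr0 scale1r comp_polyXr.
move/esym/eqP; rewrite addr_eq0 => /eqP eq_p.
have qp : q %| p.
  rewrite -(@Gauss_dvdpl _ _ (\prod_(s < n.+1 | s != 0) (q \Po (zeta ^+ s *: 'X)))).
    rewrite eq_p dvdpNr; apply: (big_ind (fun x => q %| x)) => [|x y|t t0].
      exact: dvdp0.
      exact: dvdp_add.
    by rewrite (bigD1 0) 1?eq_sym //= q_id dvdp_mull // dvdp_mulr.
  apply: (big_ind (fun x => coprimep q x)) => [|x y cx cy|t t0].
      exact: coprimep1.
    by rewrite coprimepMr cx.
  exact: copr_q.
have [// | p0] := eqVneq p 0.
have: p %= q by rewrite eqp_sym -(dvdp_size_eqp qp) eqn_leq le_pq dvdp_leq.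
case/eqpP => -[a b] /= /andP[a0 b0] eq_pq.
have := congr1 (fun p => landen_num n p q) eq_pq.
rewrite !landen_numZ num0 scaler0 landen_num_diag => /esym/eqP.
by rewrite scaler_eq0 (landen_den_eq0 prim_zeta) (negPf b0) (negPf q0).
Qed.

Lemma landen_num_surj d (A : {poly L}) : size q = d.+1 -> (size A <= d.+1)%N ->
  exists2 p : {poly L}, (size p <= d.+1)%N & landen_num n p q = A.
Proof.
move=> sq sA.
pose f : {linear 'rV[L]_d.+1 -> 'rV[L]_d.+1} := poly_rV \o landen_numr n q \o rVpoly.
have sn (v : 'rV[L]_d.+1) : (size (landen_num n (rVpoly v) q) <= d.+1)%N.
  by apply: (size_landen_num prim_zeta q0 (size_poly _ _)); rewrite sq.
have : row_free (lin1_mx f).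
  apply: inj_row_free => v; rewrite mul_rV_lin1 /= => /(congr1 rVpoly).
  rewrite poly_rV_K ?sn // linear0 => /landen_num_inj h.
  by rewrite -[v]rVpolyK h ?linear0 // sq; exact: size_poly.
rewrite row_free_unit => unitf; pose v := poly_rV A *m invmx (lin1_mx f).
exists (rVpoly v); first exact: size_poly.
have := mul_rV_lin1 f v; rewrite mulmxKV // => /(congr1 rVpoly) /=.
by rewrite /landen_numr !poly_rV_K ?sn.
Qed.

End LinearPart.

(** The leading coefficient of [q] is recorded for the charts: when that of [B] is 1, the chosen
    root is 1 as well, so the preimage keeps [b_0 = 1]. The signs cancel against the one in
    [landen_row]. *)
Lemma landen_surj (C : numClosedFieldType) n (zeta : C) d (A B : {poly C}) :
    n.+1.-primitive_root zeta ->
    (size A <= d.+1)%N -> size B = d.+1 -> B.[0] != 0 ->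
  exists p q : {poly C}, [/\ (size p <= d.+1)%N, size q = d.+1,
    lead_coef q = n.+1.-root (lead_coef B),
    landen_num n p q = (-1) ^+ (n * d) *: A &
    landen_den n q = (-1) ^+ (n * d) *: B].
Proof.
move=> pz sA sB B0; have [r BE] := closed_field_poly_normal B.
have lB0 : lead_coef B != 0 by rewrite lead_coef_eq0 -size_poly_eq0 sB.
have sr : size r = d.
  by move: sB; rewrite BE size_scale // size_prod_XsubC => -[].
pose rt := n.+1.-root : C -> C.
have rtK : cancel rt (fun x => x ^+ n.+1) by exact: rootCK.
pose q0 := \prod_(y <- map rt r) ('X - y%:P).
have mq0 : q0 \is monic by exact: monic_prod_XsubC.
pose q := rt (lead_coef B) *: q0.
have c0 : rt (lead_coef B) != 0 by rewrite rootC_eq0.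
have sq : size q = d.+1 by rewrite size_scale // size_prod_XsubC size_map sr.
have lq : lead_coef q = rt (lead_coef B) by rewrite lead_coefZ (monicP mq0) mulr1.
have dq : landen_den n q = (-1) ^+ (n * d) *: B.
  rewrite /q -mul_polyC (landen_denM pz) (landen_denC pz) (landen_den_prod pz).
  rewrite rtK size_map sr mul_polyC big_map [in RHS]BE scalerA mulrC -scalerA.
  by under eq_bigr => y _ do rewrite rtK.
have rq0 : 0 \notin r.
  apply: contra B0 => r0; rewrite BE hornerZ horner_prod.
  by rewrite (big_rem _ r0) /= hornerXsubC subrr mul0r mulr0.
have rootq x : root q x = (x \in map rt r) by rewrite rootZ // root_prod_XsubC.
clearbody q.
(* A common root gives zeta^t root(y) = root(z). Taking powers yields y = z; as the choice of roots
   is a function and root(y) is nonzero, zeta^t = 1. *)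
have copr (t : 'I_n.+1) : t != 0 -> coprimep q (q \Po (zeta ^+ t *: 'X)).
  move=> t0; apply/Pdiv.ClosedField.coprimepP => x.
  rewrite rootq => /mapP[y yr xE].
  apply: contraNneq t0; rewrite horner_comp hornerZ hornerX.
  move=> /eqP; rewrite -/(root _ _) rootq => /mapP[z zr zE].
  have yz : y = z.
    by rewrite -[y]rtK -[z]rtK -xE -zE exprMn exprAC (prim_expr_order pz) expr1n mul1r.
  have x0 : x != 0 by rewrite xE rootC_eq0 //; apply: contraNneq rq0 => <-.
  have /(mulIf x0)/eqP : zeta ^+ t * x = 1 * x by rewrite mul1r zE -yz xE.
  by rewrite -(expr0 zeta) (eq_prim_root_expr pz) mod0n modn_small.
have qn0 : q != 0 by rewrite -size_poly_eq0 sq.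
have sA' : (size ((-1) ^+ (n * d) *: A) <= d.+1)%N by rewrite size_scale // signr_eq0.
have [p sp pE] := landen_num_surj pz qn0 copr sq sA'.
by exists p, q.
Qed.

(** The denominator is a power of X - 1 up to sign, so it is enough that the numerator does not
    vanish at 1. There every summand but that of t = 0 contains q(1) = 0, and the remaining one is
    the product of the nonzero values q(zeta^s), s != 0. *)
Lemma landen_one_coprime (L : fieldType) n (zeta : L) d :
    n.+1.-primitive_root zeta ->
  coprimep (landen_num n 1 (('X - 1%:P) ^+ d.+1 : {poly L}))
    (landen_den n (('X - 1%:P) ^+ d.+1)).
Proof.
move=> pz; set q := (_ ^+ _); have z1 t : t != 0 -> zeta ^+ (t : 'I_n.+1) != 1.
  move=> t0; rewrite -(expr0 zeta) (eq_prim_root_expr pz) mod0n modn_small //.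
have -> : landen_den n q = ((-1) ^+ n *: ('X - 1%:P)) ^+ d.+1.
  rewrite /q; elim: d.+1 => [|k IH]; first by rewrite !expr0 (landen_denC pz) expr1n.
  by rewrite !exprS (landen_denM pz) IH (landen_den_XsubC pz) expr1n.
rewrite coprimep_expr // coprimepZr ?signr_eq0 // coprimep_XsubC.
have q0 : q != 0 by rewrite expf_neq0 // polyXsubC_eq0.
have := congr1 (horner^~ 1) (landen_num_comp pz 1 q0).
rewrite hornerZ horner_comp hornerXn expr1n /root => numE.
apply: contraTneq isT => num0; move: numE; rewrite num0 mulr0 horner_sum big_ord_recl.
rewrite [X in _ + X]big1 ?addr0 => [|t _]; last first.
  rewrite hornerM horner_prod (bigD1 ord0) //= expr0 scale1r comp_polyXr.
  by rewrite /q horner_exp hornerXsubC subrr exprS !mul0r mulr0.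
rewrite comp_polyC hornerM hornerC mul1r horner_prod => /esym/eqP.
apply: contraTT => _; rewrite prodf_seq_neq0; apply/allP => t _; apply/implyP => t0.
rewrite horner_comp horner_exp hornerXsubC expf_neq0 // hornerZ hornerX mulr1.
by rewrite subr_eq0 z1.
Qed.

(** * Resultants of binary forms *)

(* [form_poly] over an arbitrary ring: it is also needed over {mpoly int[n]}. *)
Definition rev_poly (R : comNzRingType) N (v : 'rV[R]_N) : {poly R} :=
  \sum_(i < N) v 0 i *: 'X^(N.-1 - i).

Section RevPoly.
Variables (R : comNzRingType) (N : nat).
Implicit Types v : 'rV[R]_N.

Lemma coef_rev_poly v (i : 'I_N) : (rev_poly v)`_(N.-1 - i) = v 0 i.
Proof.
rewrite coef_sum (bigD1 i) //= coefZ coefXn eqxx mulr1 big1 ?addr0 // => j ji.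
rewrite coefZ coefXn [_ == _](_ : _ = false) ?mulr0 //; apply/negbTE.
apply: contra ji => /eqP h; apply/eqP/val_inj => /=.
by have := ltn_ord i; have := ltn_ord j; lia.
Qed.

Lemma size_rev_poly v : (size (rev_poly v) <= N)%N.
Proof.
apply: leq_trans (size_sum _ _ _) _; apply/bigmax_leqP => i _.
apply: leq_trans (size_scale_leq _ _) _; rewrite size_polyXn.
by have := ltn_ord i; lia.
Qed.

Lemma rev_polyP (p q : {poly R}) : (size p <= N)%N -> (size q <= N)%N ->
  (forall i : 'I_N, p`_(N.-1 - i) = q`_(N.-1 - i)) -> p = q.
Proof.
move=> sp sq h; apply/polyP => k; have [lt_kN|le_Nk] := ltnP k N; last first.
  by rewrite !nth_default // (leq_trans _ le_Nk).
have lt' : (N.-1 - k < N)%N by lia.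
by have := h (Ordinal lt'); rewrite /= subKn //; lia.
Qed.

Lemma rev_poly_row (p : {poly R}) : (size p <= N)%N ->
  rev_poly (\row_(i < N) p`_(N.-1 - i)) = p.
Proof.
by move=> sp; apply: rev_polyP => // [|i]; rewrite ?size_rev_poly // coef_rev_poly mxE.
Qed.

Lemma rev_poly_inj : injective (@rev_poly R N).
Proof. by move=> u v uv; apply/rowP => i; rewrite -!coef_rev_poly uv. Qed.

Lemma rev_polyD u v : rev_poly (u + v) = rev_poly u + rev_poly v.
Proof. by rewrite -big_split; apply: eq_bigr => i _; rewrite mxE scalerDl. Qed.

Lemma rev_polyZ c v : rev_poly (c *: v) = c *: rev_poly v.
Proof. by rewrite scaler_sumr; apply: eq_bigr => i _; rewrite mxE scalerA. Qed.

Lemma rev_poly0 : rev_poly (0 : 'rV[R]_N) = 0.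
Proof. by rewrite -(scale0r 0) rev_polyZ scale0r. Qed.

End RevPoly.

Lemma form_polyE (K : fieldType) d (a : 'rV[K]_d.+1) : form_poly a = rev_poly a.
Proof. by []. Qed.

Section Resultant.

Variables (K : fieldType) (d : nat).
Hypothesis d_gt0 : (0 < d)%N.
Implicit Types a b : 'rV[K]_d.+1.

(** Read as polynomials, the rows of a Sylvester block are monomial multiples of the form, so row
    combinations are its multiples by polynomials of degree less than d. *)
Let rev_sylvester_row a i :
  rev_poly (row i (sylvester_rows a)) = 'X^(d.-1 - i) * rev_poly a.
Proof.
apply: (@rev_polyP _ (d + d)); first exact: size_rev_poly.
  apply: leq_trans (size_mul_leq _ _) _; rewrite size_polyXn.
  by have := size_rev_poly a; have := ltn_ord i; lia.
move=> j; rewrite coef_rev_poly !mxE coefXnM.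
have ltj := ltn_ord j; have lti := ltn_ord i.
have [h|h] := ltnP ((d + d).-1 - j) (d.-1 - i).
  by rewrite [(i <= j <= i + d)%N](_ : _ = false) //; lia.
have [ij|ji] := leqP i j; last first.
  by rewrite /= nth_default // (leq_trans (size_rev_poly a)) //; lia.
have -> : (j <= i + d)%N by lia.
rewrite -coef_rev_poly inordK /=; last by lia.
by congr (_`_ _); lia.
Qed.

Let rev_sylvester a (u : 'rV_d) :
  rev_poly (u *m sylvester_rows a) = rev_poly u * rev_poly a.
Proof.
rewrite mulmx_sum_row (big_morph _ (@rev_polyD _ _) (@rev_poly0 _ _)) mulr_suml.
by apply: eq_bigr => i _; rewrite rev_polyZ rev_sylvester_row scalerAl.
Qed.

(** A row vector killed by the Sylvester matrix is a relation U p + V q = 0 with U and V of degree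
    less than d. The size condition excludes a common zero at infinity, [a_0 = b_0 = 0]. *)
Lemma form_resultant_neq0 a b : (form_resultant a b != 0) =
  coprimep (form_poly a) (form_poly b) &&
  (d < maxn (size (form_poly a)) (size (form_poly b)))%N.
Proof.
rewrite !form_polyE; set p := rev_poly a; set q := rev_poly b.
apply/idP/idP; last first.
  case/andP=> copr; rewrite leq_max => smax; apply/negP => /det0P[w w0].
  rewrite -[w]hsubmxK mul_row_col => /(congr1 (@rev_poly _ _)).
  rewrite rev_polyD !rev_sylvester rev_poly0 -/p -/q.
  set u := lsubmx w; set v := rsubmx w => uv0.
  have su := size_rev_poly u; have sv := size_rev_poly v.
  suff [u0 v0] : rev_poly u = 0 /\ rev_poly v = 0.
    case/eqP: w0; rewrite -[w]hsubmxK -/u -/v.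
    rewrite (_ : u = 0) 1?(_ : v = 0) ?row_mx0 //; apply: rev_poly_inj;
      by rewrite rev_poly0.
  have uvE : rev_poly u * p = - (rev_poly v * q) by apply/eqP; rewrite -addr_eq0 uv0.
  case/orP: smax => [sp|sq].
    have v0 : rev_poly v = 0.
      apply/eqP; apply: contraTT sp => v0; rewrite -leqNgt (leq_trans _ sv) // dvdp_leq //.
      by rewrite -(Gauss_dvdpl _ copr) -dvdpNr -uvE dvdp_mull.
    split=> //; move/eqP: uvE; rewrite v0 mul0r oppr0 mulf_eq0.
    case/orP=> [/eqP//|/eqP p0].
    by move: sp; rewrite p0 size_poly0.
  have u0 : rev_poly u = 0.
    apply/eqP; apply: contraTT sq => u0; rewrite -leqNgt (leq_trans _ su) // dvdp_leq //.
    by rewrite -(@Gauss_dvdpl _ _ p) 1?coprimep_sym // uvE dvdpNr dvdp_mull.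
  split=> //; move/esym/eqP: uvE; rewrite u0 mul0r oppr_eq0 mulf_eq0.
  case/orP=> [/eqP//|/eqP q0].
  by move: sq; rewrite q0 size_poly0.
apply: contraR => ncopr; apply/det0P.
suff [U [V [sU sV UV0 UVE]]] : exists U V : {poly K},
    [/\ (size U <= d)%N, (size V <= d)%N, (U != 0) || (V != 0) & U * p + V * q = 0].
  exists (row_mx (\row_(i < d) U`_(d.-1 - i)) (\row_(i < d) V`_(d.-1 - i))).
    apply: contraTneq UV0; rewrite -[RHS]row_mx0 => /eq_row_mx[u0 v0].
    by rewrite -(rev_poly_row sU) -(rev_poly_row sV) u0 v0 rev_poly0 eqxx.
  apply: rev_poly_inj; rewrite mul_row_col rev_polyD !rev_sylvester !rev_poly_row //.
  by rewrite UVE rev_poly0.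
(* If both forms vanish there is no gcd to divide by, but any pair is a relation; [1] is short
   enough because d is positive. *)
have [/andP[/eqP p0 /eqP q0]|pq0] := boolP ((p == 0) && (q == 0)).
  by exists 1, 0; rewrite size_poly1 size_poly0 oner_eq0 p0 mulr0 mul0r addr0.
have g0 : gcdp p q != 0 by rewrite gcdp_eq0.
(* The minimal relation. Its entries have size at most d either because the gcd is nonconstant or
   because both forms lack their top coefficient. *)
exists (q %/ gcdp p q), (- (p %/ gcdp p q)).
have sp := size_rev_poly a : (size p <= d.+1)%N.
have sq := size_rev_poly b : (size q <= d.+1)%N.
have sg : gcdp p q != 0 -> (0 < size (gcdp p q))%N by rewrite lt0n size_poly_eq0.
have small : (1 < size (gcdp p q))%N || (maxn (size p) (size q) <= d)%N.
  move: ncopr; rewrite negb_and -leqNgt => /orP[nc|->]; last by rewrite orbT.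
  by rewrite ltn_neqAle sg // andbT eq_sym -/(coprimep p q) nc.
have bound s : (s <= d.+1)%N -> (s <= maxn (size p) (size q))%N ->
    (s - (size (gcdp p q)).-1 <= d)%N.
  case/orP: small => [lt1g ssd _|smax _ ssm].
    rewrite leq_subLR (leq_trans ssd) // -add1n leq_add2r.
    by case: (size _) lt1g => [|[]].
  exact: leq_trans (leq_subr _ _) (leq_trans ssm smax).
rewrite size_polyN !size_divp //; split.
- exact: bound (leq_maxr _ _).
- exact: bound (leq_maxl _ _).
- by rewrite oppr_eq0 !dvdp_div_eq0 ?dvdp_gcdl ?dvdp_gcdr // -negb_and andbC.
set g := gcdp p q; set p' := p %/ g; set q' := q %/ g.
have pE : p' * g = p by rewrite divpK ?dvdp_gcdl.
have qE : q' * g = q by rewrite divpK ?dvdp_gcdr.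
transitivity (q' * (p' * g) - p' * (q' * g)); first by rewrite pE qE mulNr.
by rewrite mulrCA subrr.
Qed.

End Resultant.

(** * Integral polynomials as functions *)

Lemma eq_digits B n (f g : nat -> nat) :
    (forall i, (i < n)%N -> (f i < B)%N) -> (forall i, (i < n)%N -> (g i < B)%N) ->
    (\sum_(i < n) f i * B ^ i = \sum_(i < n) g i * B ^ i)%N ->
  forall i, (i < n)%N -> f i = g i.
Proof.
elim: n f g => [//|n IH] f g fB gB.
have split_digit (h : nat -> nat) : (\sum_(i < n.+1) h i * B ^ i =
    (\sum_(i < n) h i.+1 * B ^ i) * B + h 0)%N.
  rewrite big_ord_recl expn0 muln1 addnC big_distrl /=; congr (_ + _)%N.
  by apply: eq_bigr => i _; rewrite /bump /= add1n expnSr mulnA.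
rewrite !split_digit => eq_fg.
have B0 : (0 < B)%N by have := fB 0%N isT; lia.
have eq0 : f 0%N = g 0%N.
  have := congr1 (modn^~ B) eq_fg.
  by rewrite !modnMDl !modn_small ?fB ?gB.
have eqS : (\sum_(i < n) f i.+1 * B ^ i = \sum_(i < n) g i.+1 * B ^ i)%N.
  by apply/eqP; rewrite -(eqn_pmul2r B0); move: eq_fg; rewrite eq0 => /addIn ->.
case=> [//|i]; apply: (IH (fun j => f j.+1) (fun j => g j.+1) _ _ eqS) => j lt_j.
  exact: fB.
exact: gB.
Qed.

Lemma poly_eq0_nat (F : numDomainType) (p : {poly F}) :
  (forall k : nat, p.[k%:R] = 0) -> p = 0.
Proof.
move=> p0; apply: (@roots_geq_poly_eq0 _ p [seq i%:R | i <- iota 0 (size p)]).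
- by apply/allP => _ /mapP[k _ ->]; apply/eqP/p0.
- by rewrite map_inj_uniq ?iota_uniq // => i j /eqP; rewrite eqr_nat => /eqP.
- by rewrite size_map size_iota.
Qed.

(* Kronecker substitution x_i = t^(B^i), with B larger than every exponent. *)
Lemma mmap_int_eq0 (F : numFieldType) n (p : {mpoly int[n]}) :
  (forall x : 'I_n -> F, mmap intr x p = 0) -> p = 0.
Proof.
move=> p0; pose B := msize p.
pose kr (m : 'X_{1..n}) := (\sum_(i < n) m i * B ^ i)%N.
pose P : {poly F} := \sum_(m <- msupp p) (p@_m)%:~R *: 'X^(kr m).
have P0 : P = 0.
  apply: poly_eq0_nat => k; rewrite -(p0 (fun i => k%:R ^+ (B ^ i)%N)) horner_sum.
  apply: eq_bigr => m _; rewrite hornerZ hornerXn /mmap1 /kr -prodrXr.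
  by congr (_ * _); apply: eq_bigr => i _; rewrite -exprM mulnC.
have ltB m : m \in msupp p -> forall i, (m i < B)%N.
  move=> mp i; apply: leq_ltn_trans (msize_mdeg_lt mp).
  by rewrite mdegE (bigD1 i) //= leq_addr.
have kr_inj : {in msupp p &, injective kr}.
  move=> m m' mp mp' eq_kr; apply/mnmP => i.
  pose dig (u : 'X_{1..n}) j := if insub j is Some j' then u (j' : 'I_n) else 0%N.
  have digE u (j : 'I_n) : dig u j = u j by rewrite /dig valK.
  rewrite -!digE; apply: (@eq_digits B n (dig m) (dig m')) => // [j lt_j|j lt_j|].
  - by rewrite (digE _ (Ordinal lt_j)) ltB.
  - by rewrite (digE _ (Ordinal lt_j)) ltB.
  under eq_bigr => j _ do rewrite digE.
  by under [RHS]eq_bigr => j _ do rewrite digE.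
apply/mpolyP => m; rewrite mcoeff0; apply/eqP; rewrite mcoeff_eq0; apply/negP => mp.
have := congr1 (fun q : {poly F} => q`_(kr m)) P0; rewrite coef0 coef_sum.
rewrite (bigD1_seq m) ?msupp_uniq //= coefZ coefXn eqxx mulr1 big_seq_cond big1.
  by move/eqP; rewrite addr0 intr_eq0 mcoeff_eq0 mp.
move=> m' /andP[mp' m'm]; rewrite coefZ coefXn.
by case: eqP => [/kr_inj h|]; rewrite ?mulr0 //; rewrite h ?eqxx in m'm.
Qed.

Lemma mpeval_eq0 (F : numFieldType) n (p : {mpoly int[n]}) :
  (forall P : 'rV[F]_n, mpeval P p = 0) -> p = 0.
Proof.
move=> p0; apply: (@mmap_int_eq0 F) => x; rewrite -(p0 (\row_i x i)).
rewrite /mpeval /mmap; apply: eq_bigr => m _; congr (_ * _).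
by apply: mmap1_eq => i; rewrite mxE.
Qed.

(** * The Landen transform in coordinates *)

Lemma map_rev_poly (R S : comNzRingType) (f : {rmorphism R -> S}) N (v : 'rV[R]_N) :
  map_poly f (rev_poly v) = rev_poly (map_mx f v).
Proof.
rewrite /rev_poly rmorph_sum; apply: eq_bigr => i _ /=.
by rewrite map_polyZ map_polyXn mxE.
Qed.

Lemma mulmx_ofZ (R : comNzRingType) n c (q : {poly R}) :
  mulmx_of n (c *: q) = c%:P *: mulmx_of n q.
Proof.
apply/matrixP => i j; rewrite !mxE mul_polyC -scalerAl.
by rewrite -[in LHS](addr0 (c *: _)) poly_section_is_linear (_ : poly_section n i 0 = 0)
   ?addr0 //; apply/polyP => k; rewrite coef_poly_section !coef0.
Qed.

Lemma landen_denZ (R : comNzRingType) n c (q : {poly R}) :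
  landen_den n (c *: q) = c ^+ n.+1 *: landen_den n q.
Proof. by rewrite /landen_den mulmx_ofZ detZ -polyC_exp mul_polyC. Qed.

Lemma landen_numZZ (R : comNzRingType) n c (p q : {poly R}) :
  landen_num n (c *: p) (c *: q) = c ^+ n.+1 *: landen_num n p q.
Proof.
rewrite landen_numZ /landen_num mulmx_ofZ adjZ -scalemxAr mxE /=.
by rewrite -polyC_exp mul_polyC scalerA exprS.
Qed.

(* The sign makes the coordinate b_0 of the image equal to b_0 ^ n.+1. *)
Definition landen_row (R : comNzRingType) n d (P : 'rV[R]_(ncoord d)) :
    'rV[R]_(ncoord d) :=
  let p := rev_poly (lsubmx P) in
  let q := rev_poly (rsubmx P) in
  (-1) ^+ (n * d) *: row_mx (\row_(i < d.+1) (landen_num n p q)`_(d - i))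
                            (\row_(i < d.+1) (landen_den n q)`_(d - i)).

Lemma map_landen_row (R S : comNzRingType) (f : {rmorphism R -> S}) n d P :
  map_mx f (@landen_row R n d P) = landen_row n (map_mx f P).
Proof.
rewrite /landen_row map_mxZ rmorphXn rmorphN1; congr (_ *: _).
rewrite map_row_mx -map_lsubmx -map_rsubmx -!map_rev_poly.
rewrite -map_landen_num -map_landen_den.
by congr row_mx; apply/rowP => i; rewrite !mxE coef_map.
Qed.

Lemma landen_rowZ (R : comNzRingType) n d c (P : 'rV[R]_(ncoord d)) :
  landen_row n (c *: P) = c ^+ n.+1 *: landen_row n P.
Proof.
rewrite /landen_row linearZ [rsubmx _]linearZ /= !rev_polyZ landen_denZ landen_numZZ.
rewrite scalerA mulrC -scalerA; congr (_ *: _).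
rewrite scale_row_mx; congr row_mx;
  by apply/rowP => i; rewrite !mxE coefZ.
Qed.

(* Opaque on purpose: comparing the explicit tuples for two values of n makes
   unification diverge. *)
Lemma landen_coords_spec n d : {f : (ncoord d).-tuple {mpoly int[ncoord d]} |
  forall (K : fieldType) (P : 'rV[K]_(ncoord d)), mpeval_tuple f P = landen_row n P}.
Proof.
exists [tuple landen_row n (\row_j 'X_j) 0 i | i < ncoord d] => K P.
pose f : {rmorphism {mpoly int[ncoord d]} -> K} := mmap intr (fun i => P 0 i).
have PE : map_mx f (\row_j 'X_j) = P.
  by apply/rowP => i; rewrite !mxE /= mmapX mmap1U.
rewrite -[in RHS]PE -map_landen_row; apply/rowP => i.
by rewrite [LHS]mxE [RHS]mxE tnth_mktuple.
Qed.

Definition landen_coords n d := sval (landen_coords_spec n d).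

Lemma mpeval_landen (K : fieldType) n d (P : 'rV[K]_(ncoord d)) :
  mpeval_tuple (landen_coords n d) P = landen_row n P.
Proof. exact: (svalP (landen_coords_spec n d)). Qed.

(** Scaling by 2 alone suffices: it multiplies a monomial of degree k by 2^k, and distinct k give
    distinct integers 2^k. *)
Lemma dhomog_scaling (F : numFieldType) n e (p : {mpoly int[n]}) :
  (forall P : 'rV[F]_n, mpeval (2 *: P) p = 2 ^+ e * mpeval P p) -> p \is e.-homog.
Proof.
move=> pZ; pose p' : {mpoly int[n]} :=
  \sum_(m <- msupp p) (p@_m * 2 ^+ mdeg m) *: 'X_[m] - 2 ^+ e *: p.
have p'0 : p' = 0.
  apply: (@mpeval_eq0 F) => P; rewrite /mpeval mmapB mmapZ rmorphXn /=.
  rewrite -[X in _ - _ * X]/(mpeval P p) -[X in _ - X * _]/(2 ^+ e) -pZ; apply/eqP.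
  rewrite subr_eq0 raddf_sum /= /mpeval /mmap; apply/eqP/eq_bigr => m _.
  rewrite [LHS]mmapZ mmapX rmorphM rmorphXn /= -mulrA; congr (_ * _).
  rewrite mdegE -prodrXr -big_split; apply: eq_bigr => i _ /=.
  by rewrite mxE exprMn.
apply/dhomogP => m mp; have := congr1 (mcoeff m) p'0.
rewrite mcoeffB mcoeffZ mcoeff0 raddf_sum /= (bigD1_seq m) ?msupp_uniq //=.
rewrite mcoeffZ mcoeffX eqxx mulr1 big1 => [|m' /negPf m'm]; last first.
  by rewrite mcoeffZ mcoeffX m'm mulr0.
rewrite addr0 mulrC -mulrBl => /eqP; rewrite mulf_eq0 mcoeff_eq0 mp orbF subr_eq0.
by move=> /eqP; exact: (@ieexprIn int 2).
Qed.

Section RowCoordinates.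

Variables (R : comNzRingType) (n d : nat).
Implicit Types P : 'rV[R]_(ncoord d).

Lemma rev_poly_lsub_landen P
    (A := landen_num n (rev_poly (lsubmx P)) (rev_poly (rsubmx P))) :
  (size A <= d.+1)%N -> rev_poly (lsubmx (landen_row n P)) = (-1) ^+ (n * d) *: A.
Proof.
move=> sA; rewrite /landen_row scale_row_mx row_mxKl rev_polyZ.
by congr (_ *: _); rewrite rev_poly_row.
Qed.

Lemma rev_poly_rsub_landen P (B := landen_den n (rev_poly (rsubmx P))) :
  (size B <= d.+1)%N -> rev_poly (rsubmx (landen_row n P)) = (-1) ^+ (n * d) *: B.
Proof.
move=> sB; rewrite /landen_row scale_row_mx row_mxKr rev_polyZ.
by congr (_ *: _); rewrite rev_poly_row.
Qed.

Lemma row_eq_rev P Q : rev_poly (lsubmx P) = rev_poly (lsubmx Q) ->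
  rev_poly (rsubmx P) = rev_poly (rsubmx Q) -> P = Q.
Proof.
move=> /rev_poly_inj l /rev_poly_inj r; by rewrite -[P]hsubmxK -[Q]hsubmxK l r.
Qed.

Lemma coef_rev_polyE (v : 'rV[R]_d.+1) i :
  (i <= d)%N -> (rev_poly v)`_i = v 0 (inord (d - i)).
Proof.
move=> le_id; rewrite -[in RHS](coef_rev_poly v) inordK /=; last by lia.
by rewrite subKn.
Qed.

Lemma first_coefE (v : 'rV[R]_d.+1) : v 0 0 = (rev_poly v)`_d.
Proof.
by rewrite coef_rev_polyE // subnn; congr (v 0 _); apply/val_inj; rewrite /= inordK.
Qed.

Lemma last_coefE (v : 'rV[R]_d.+1) : v 0 ord_max = (rev_poly v).[0].
Proof.
rewrite horner_coef0 coef_rev_polyE // subn0; congr (v 0 _).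
by apply/val_inj; rewrite /= inordK.
Qed.

End RowCoordinates.

Section Row.

Variables (L : fieldType) (n : nat) (zeta : L) (d : nat).
Hypothesis prim_zeta : n.+1.-primitive_root zeta.
Implicit Types (P : 'rV[L]_(ncoord d)) (p q : {poly L}).

Lemma coef_landen_den_top q : (size q <= d.+1)%N ->
  (landen_den n q)`_d = (-1) ^+ (n * d) * q`_d ^+ n.+1.
Proof.
rewrite leq_eqVlt => /orP[/eqP sq|]; last first.
  rewrite ltnS => sq; rewrite !nth_default ?(size_landen_den prim_zeta) //.
  by rewrite expr0n mulr0.
have := lead_coef_landen_den prim_zeta q.
by rewrite /lead_coef (size_landen_den prim_zeta) sq.
Qed.

(** Subtracting from p the multiple of q with the same top coefficient leaves a remainder whose
    numerator has degree less than d; the multiple of q contributes that multiple of the norm. *)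
Lemma coef_landen_num_top p q : (size p <= d.+1)%N -> (size q <= d.+1)%N ->
    q`_d != 0 ->
  (landen_num n p q)`_d = (-1) ^+ (n * d) * (p`_d * q`_d ^+ n).
Proof.
move=> sp sq qd; pose c := p`_d / q`_d; pose r := p - c *: q.
have q0 : q != 0 by apply: contraNneq qd => ->; rewrite coef0.
have sr : (size r <= d)%N.
  apply/leq_sizeP => j; rewrite leq_eqVlt => /orP[/eqP <-|lt_dj].
    by rewrite coefB coefZ divfK // subrr.
  by rewrite coefB coefZ !nth_default ?mulr0 ?subr0 // (leq_trans _ lt_dj).
have -> : p = c *: q + r by rewrite addrC subrK.
rewrite landen_num_is_linear landen_num_diag coefD [X in _ + X]nth_default; last first.
  exact: (size_landen_num_lt prim_zeta).
rewrite addr0 coefZ coef_landen_den_top // coefD coefZ [r`_d]nth_default // addr0.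
by rewrite mulrCA exprS !mulrA.
Qed.

Let size_num P : rsubmx P != 0 ->
  (size (landen_num n (rev_poly (lsubmx P)) (rev_poly (rsubmx P))) <= d.+1)%N.
Proof.
move=> P0; apply: (size_landen_num prim_zeta); rewrite ?size_rev_poly //.
by rewrite -(rev_poly0 L d.+1) (inj_eq (@rev_poly_inj _ _)).
Qed.

Let size_den P : (size (landen_den n (rev_poly (rsubmx P))) <= d.+1)%N.
Proof. by rewrite (size_landen_den prim_zeta) size_rev_poly. Qed.

Lemma rev_landen_l P : rsubmx P != 0 -> rev_poly (lsubmx (landen_row n P)) =
  (-1) ^+ (n * d) *: landen_num n (rev_poly (lsubmx P)) (rev_poly (rsubmx P)).
Proof. by move=> P0; rewrite rev_poly_lsub_landen ?size_num. Qed.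

Lemma rev_landen_r P : rev_poly (rsubmx (landen_row n P)) =
  (-1) ^+ (n * d) *: landen_den n (rev_poly (rsubmx P)).
Proof. by rewrite rev_poly_rsub_landen. Qed.

(** The explicit coordinates serve two ends: [b_0] and [a_0] show that the affine loci are
    preserved, while [b_0] and [b_d] exclude a common factor. *)
Lemma landen_row_b0 P : rsubmx (landen_row n P) 0 0 = rsubmx P 0 0 ^+ n.+1.
Proof.
rewrite !first_coefE rev_landen_r coefZ coef_landen_den_top ?size_rev_poly //.
exact: signrMK.
Qed.

Lemma landen_row_a0 P : rsubmx P 0 0 != 0 ->
  lsubmx (landen_row n P) 0 0 = lsubmx P 0 0 * rsubmx P 0 0 ^+ n.
Proof.
move=> P0; rewrite !first_coefE rev_landen_l; last first.
  by apply: contraNneq P0 => ->; rewrite mxE.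
by rewrite coefZ coef_landen_num_top ?size_rev_poly -?first_coefE // signrMK.
Qed.

Lemma landen_row_bd P : rsubmx (landen_row n P) 0 ord_max =
  (-1) ^+ (n * d) * rsubmx P 0 ord_max ^+ n.+1.
Proof.
by rewrite !last_coefE rev_landen_r hornerZ (landen_den_at0 prim_zeta).
Qed.

End Row.

Lemma landen_row_comp (L : fieldType) n k N (zeta : L) d (P : 'rV[L]_(ncoord d)) :
    N.+1 = (k.+1 * n.+1)%N -> N.+1.-primitive_root zeta -> rsubmx P != 0 ->
  landen_row n (landen_row k P) = landen_row N P.
Proof.
move=> NE pz P0.
have pn := prim_root_exp_factor NE pz.
have NE' : N.+1 = (n.+1 * k.+1)%N by rewrite NE mulnC.
have pk := prim_root_exp_factor NE' pz.
have q0 : rev_poly (rsubmx P) != 0.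
  by rewrite -(rev_poly0 L d.+1) (inj_eq (@rev_poly_inj _ _)).
have kP0 : rsubmx (landen_row k P) != 0.
  rewrite -(inj_eq (@rev_poly_inj _ _)) rev_poly0 (rev_landen_r pk).
  by rewrite scaler_eq0 signr_eq0 (landen_den_eq0 pk).
(* From N + 1 = (k + 1)(n + 1) one has N = n + k(n + 1). *)
have signE : (-1) ^+ (n * d) * ((-1) ^+ (k * d)) ^+ n.+1 = (-1) ^+ (N * d) :> L.
  by rewrite -exprM -exprD; congr (_ ^+ _); lia.
apply: row_eq_rev.
  rewrite (rev_landen_l pn) // (rev_landen_l pk) // (rev_landen_r pk).
  rewrite (rev_landen_l pz) //.
  by rewrite landen_numZZ scalerA signE (landen_num_num _ NE pz).
rewrite (rev_landen_r pn) // (rev_landen_r pk) // (rev_landen_r pz) //.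
by rewrite landen_denZ scalerA signE (landen_den_den NE pz).
Qed.

Lemma landen_row_surj (C : numClosedFieldType) n (zeta : C) d
    (Q : 'rV[C]_(ncoord d)) :
    n.+1.-primitive_root zeta -> rsubmx Q 0 0 != 0 -> rsubmx Q 0 ord_max != 0 ->
  exists2 P, landen_row n P = Q & rsubmx P 0 0 = n.+1.-root (rsubmx Q 0 0).
Proof.
move=> pz Q0 Qd.
have sB : size (rev_poly (rsubmx Q)) = d.+1.
  apply/eqP; rewrite eqn_leq size_rev_poly ltnNge; apply: contra Q0 => s.
  by rewrite first_coefE nth_default.
have := landen_surj pz (size_rev_poly (lsubmx Q)) sB.
rewrite -last_coefE => /(_ Qd).
case=> p [q [sp sq lq numE denE]].
exists (row_mx (\row_(i < d.+1) p`_(d - i)) (\row_(i < d.+1) q`_(d - i))).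
  apply: row_eq_rev.
    rewrite (rev_landen_l pz) row_mxKr ?row_mxKl.
      by rewrite !rev_poly_row ?sq // numE scalerA -expr2 sqrr_sign scale1r.
    apply/eqP => /rowP/(_ ord0); rewrite !mxE subn0 => /eqP.
    have <- : lead_coef q = q`_d by rewrite /lead_coef sq.
    by rewrite lead_coef_eq0 -size_poly_eq0 sq.
  rewrite (rev_landen_r pz) row_mxKr !rev_poly_row ?sq // denE scalerA -expr2.
  by rewrite sqrr_sign scale1r.
by rewrite row_mxKr mxE subn0 first_coefE; move: lq; rewrite /lead_coef sq sB.
Qed.

(** * Rational functions as fractions *)

Lemma frac_repr (R : idomainType) (f : {fraction R}) :
  f = (\n_(repr f))%:F / (\d_(repr f))%:F.
Proof.
have d0 : (\d_(repr f))%:F != 0 :> {fraction R} by rewrite tofrac_eq0 denom_ratioP.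
apply: (mulIf d0); rewrite divfK //; unlock FracField.tofrac.
rewrite -{1}[f]reprK -[LHS]FracField.pi_mul; apply/eqmodP => /=.
rewrite FracField.equivfE /FracField.mulf.
rewrite !numden_Ratio ?mulf_neq0 ?oner_neq0 ?denom_ratioP //.
by rewrite !mulr1 mulrC.
Qed.

Lemma eq_frac (R : idomainType) (a b c e : R) : b != 0 -> e != 0 ->
  (a%:F / b%:F == c%:F / e%:F) = (a * e == c * b).
Proof. by move=> b0 e0; rewrite eqr_div ?tofrac_eq0 // -!tofracM tofrac_eq. Qed.

Lemma denom_repr_neq0 (R : idomainType) (f : {fraction R}) : \d_(repr f) != 0.
Proof. exact: denom_ratioP. Qed.

Lemma ratfun_subst_frac (K L : fieldType) (iota : {rmorphism K -> L})
    (q : {poly L}) (u v : {poly K}) : (1 < size q)%N -> v != 0 ->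
  ratfun_subst iota q (u%:F / v%:F) =
  (map_poly iota u \Po q)%:F / (map_poly iota v \Po q)%:F.
Proof.
move=> sq v0; rewrite /ratfun_subst; set f := u%:F / v%:F.
have d0 := denom_repr_neq0 f.
apply/eqP; rewrite eq_frac ?comp_poly_eq0 ?map_poly_eq0 // -!comp_polyM -!rmorphM.
by apply/eqP; congr (map_poly _ _ \Po _); apply/eqP; rewrite -eq_frac // -frac_repr.
Qed.

Lemma ratfun_subst_inj (K L : fieldType) (iota : {rmorphism K -> L})
    (q : {poly L}) :
  (1 < size q)%N -> injective (ratfun_subst iota q).
Proof.
move=> sq f g; rewrite (frac_repr f) (frac_repr g).
rewrite !ratfun_subst_frac ?denom_repr_neq0 //.
move/eqP; rewrite eq_frac ?comp_poly_eq0 ?map_poly_eq0 ?denom_repr_neq0 //.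
rewrite -!comp_polyM -!rmorphM -subr_eq0 -comp_polyB comp_poly_eq0 //.
by rewrite subr_eq0 => /eqP/map_poly_inj => h; apply/eqP; rewrite eq_frac ?denom_repr_neq0 ?h.
Qed.

Lemma reduced_frac (K : fieldType) (A B p q : {poly K}) : q != 0 -> B != 0 ->
    p * B = A * q ->
  exists h, [/\ h != 0, A = p %/ gcdp p q * h & B = q %/ gcdp p q * h].
Proof.
move=> q0 B0 eq_frac; set g := gcdp p q.
have g0 : g != 0 by rewrite gcdp_eq0 negb_and q0 orbT.
set p' := p %/ g; set q' := q %/ g.
have pE : p' * g = p by rewrite divpK ?dvdp_gcdl.
have qE : q' * g = q by rewrite divpK ?dvdp_gcdr.
have q'0 : q' != 0 by apply: contraNneq q0 => q'0; rewrite -qE q'0 mul0r.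
have copr : coprimep q' p'.
  rewrite coprimep_sym; apply: coprimep_div_gcd; by rewrite q0 orbT.
have eq' : p' * B = A * q'.
  by apply: (mulIf g0); rewrite mulrAC pE eq_frac -mulrA qE.
have : q' %| B by rewrite -(Gauss_dvdpr _ copr) eq' dvdp_mull.
case/dvdpP => h BE; exists h; split; last by rewrite BE mulrC.
  by apply: contraNneq B0 => h0; rewrite BE h0 mul0r.
by apply: (mulIf q'0); rewrite -eq' BE mulrA.
Qed.

(** [A] and [B] are a common multiple, by some h, of the reduced pair. Degree d leaves no room for a
    nonconstant h, and conversely coprimality makes h constant. The resulting condition is the
    criterion of [form_resultant_neq0], which links the degree to [in_Rat]. *)
Lemma ratfun_deg_frac (K : fieldType) (A B : {poly K}) d : (0 < d)%N -> B != 0 ->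
    (size A <= d.+1)%N -> (size B <= d.+1)%N ->
  (ratfun_deg (A%:F / B%:F) == d) =
  coprimep A B && (d < maxn (size A) (size B))%N.
Proof.
move=> d0 B0 sA sB; rewrite /ratfun_deg; set f := A%:F / B%:F.
set p := \n_(repr f); set q := \d_(repr f).
have q0 : q != 0 by exact: denom_repr_neq0.
have eq_pq : p * B = A * q by apply/eqP; rewrite -eq_frac // -frac_repr.
have [h [h0 AE BE]] := reduced_frac q0 B0 eq_pq.
set p' := p %/ gcdp p q in AE *; set q' := q %/ gcdp p q in BE *.
have copr : coprimep p' q' by apply: coprimep_div_gcd; rewrite q0 orbT.
have sh : (0 < size h)%N by rewrite lt0n size_poly_eq0.
have szM r : r != 0 -> size (r * h) = (size r + (size h).-1)%N.
  by move=> r0; rewrite size_mul // -subn1 -addnBA // subn1.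
have ltd (x : nat) : x.-1 = d -> (d < x)%N by lia.
apply/eqP/andP => [sd | [coprAB smax]].
  have sz1 : size h = 1%N.
    apply/eqP; rewrite eqn_leq sh andbT leqNgt; apply/negP => lt1h.
    have := ltd _ sd.
    rewrite leq_max => /orP[] lt_d.
      have r0 : p' != 0 by rewrite -size_poly_gt0 (leq_trans _ lt_d).
      by move: sA; rewrite AE szM //; lia.
    have r0 : q' != 0 by rewrite -size_poly_gt0 (leq_trans _ lt_d).
    by move: sB; rewrite BE szM //; lia.
  move/eqP/size_poly1P: sz1 => [c c0 hE].
  rewrite AE BE hE ![_ * c%:P]mulrC !mul_polyC coprimepZl // coprimepZr //.
  rewrite !size_scale //.
  by split=> //; exact: ltd.
have : h %= 1.
  by move/coprimepP: coprAB; apply; rewrite ?AE ?BE dvdp_mull.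
rewrite -size_poly_eq1 => /size_poly1P[c c0 hE].
move: smax; rewrite AE BE hE ![_ * c%:P]mulrC !mul_polyC !size_scale // => smax.
apply/eqP; rewrite -eqSS prednK; last by rewrite (leq_trans _ smax).
rewrite eqn_leq smax andbT geq_max.
have /andP[-> ->] // : (size p' <= d.+1)%N && (size q' <= d.+1)%N.
by move: sA sB; rewrite AE BE hE ![_ * c%:P]mulrC !mul_polyC !size_scale // => -> ->.
Qed.

(** * The Landen transform as a rational map over the integers *)

Lemma mpeval_is_zmod_morphism (K : fieldType) n (P : 'rV[K]_n) :
  zmod_morphism (mpeval P).
Proof. exact: raddfB. Qed.

Lemma mpeval_is_monoid_morphism (K : fieldType) n (P : 'rV[K]_n) :
  monoid_morphism (mpeval P).
Proof. by split=> [|p q]; rewrite /mpeval ?rmorph1 ?rmorphM. Qed.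

HB.instance Definition _ (K : fieldType) n (P : 'rV[K]_n) :=
  GRing.isZmodMorphism.Build {mpoly int[n]} K (mpeval P)
    (mpeval_is_zmod_morphism P).

HB.instance Definition _ (K : fieldType) n (P : 'rV[K]_n) :=
  GRing.isMonoidMorphism.Build {mpoly int[n]} K (mpeval P)
    (mpeval_is_monoid_morphism P).

Lemma mpevalX (K : fieldType) n (P : 'rV[K]_n) i : mpeval P 'X_i = P 0 i.
Proof. by rewrite /mpeval mmapX mmap1U. Qed.

Lemma mpeval_comp (K : fieldType) n k (P : 'rV[K]_k) (t : n.-tuple {mpoly int[k]}) p :
  mpeval P (p \mPo t) = mpeval (mpeval_tuple t P) p.
Proof.
rewrite comp_mpolyE raddf_sum /=; apply: eq_bigr => m _.
rewrite -mul_mpolyC rmorphM /= {1}/mpeval mmapC rmorph_prod; congr (_ * _).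
by apply: eq_bigr => i _; rewrite rmorphXn mxE.
Qed.

Lemma mpeval_tupleE (K : fieldType) n k (P : 'rV[K]_k) (t : n.-tuple {mpoly int[k]}) i :
  mpeval P (tnth t i) = mpeval_tuple t P 0 i.
Proof. by rewrite mxE. Qed.

Lemma mpeval_eq0_off (F : numFieldType) n (D p : {mpoly int[n]}) : D != 0 ->
  (forall P : 'rV[F]_n, mpeval P D != 0 -> mpeval P p = 0) -> p = 0.
Proof.
move=> D0 Dp; apply: (mulfI D0); rewrite mulr0; apply: (@mpeval_eq0 F) => P.
rewrite rmorphM /=.
by have [->|/Dp ->] := eqVneq (mpeval P D) 0; rewrite ?mul0r ?mulr0.
Qed.

Lemma mpoly_eq_off (F : numFieldType) n (D p q : {mpoly int[n]}) : D != 0 ->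
  (forall P : 'rV[F]_n, mpeval P D != 0 -> mpeval P p = mpeval P q) -> p = q.
Proof.
move=> D0 Dpq; apply/eqP; rewrite -subr_eq0; apply/eqP.
apply: (@mpeval_eq0_off F _ _ _ D0) => P PD.
by rewrite rmorphB /= Dpq ?subrr.
Qed.

Lemma mpolyXi_neq0 n (i : 'I_n) : 'X_i != 0 :> {mpoly int[n]}.
Proof. by rewrite -msize_poly_eq0 msizeX. Qed.

Local Notation b0 d := (rshift d.+1 (ord0 : 'I_d.+1)).
Local Notation bd d := (rshift d.+1 (ord_max : 'I_d.+1)).
Local Notation a0 d := (lshift d.+1 (ord0 : 'I_d.+1)).

Lemma landen_coords_b0 n d : tnth (landen_coords n d) (b0 d) = 'X_(b0 d) ^+ n.+1.
Proof.
have [zeta pz] := C_prim_root_exists (ltn0Sn n).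
apply: (@mpoly_eq_off algC _ 1 _ _ (oner_neq0 _)) => P _.
rewrite mpeval_tupleE mpeval_landen rmorphXn /= mpevalX.
by have := landen_row_b0 pz P; rewrite !mxE.
Qed.

Lemma landen_coords_bd n d :
  tnth (landen_coords n d) (bd d) = (-1) ^+ (n * d) * 'X_(bd d) ^+ n.+1.
Proof.
have [zeta pz] := C_prim_root_exists (ltn0Sn n).
apply: (@mpoly_eq_off algC _ 1 _ _ (oner_neq0 _)) => P _.
rewrite mpeval_tupleE mpeval_landen rmorphM !rmorphXn rmorphN1 /= mpevalX.
by have := landen_row_bd pz P; rewrite !mxE.
Qed.

Lemma landen_coords_a0 n d :
  tnth (landen_coords n d) (a0 d) = 'X_(a0 d) * 'X_(b0 d) ^+ n.
Proof.
have [zeta pz] := C_prim_root_exists (ltn0Sn n).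
apply: (@mpoly_eq_off algC _ _ _ _ (mpolyXi_neq0 (b0 d))) => P; rewrite mpevalX => P0.
rewrite mpeval_tupleE mpeval_landen rmorphM rmorphXn /= !mpevalX.
have := landen_row_a0 pz (P := P); rewrite mxE => /(_ P0).
by rewrite !mxE.
Qed.

(** K may contain no primitive root of unity, and has none in any extension if m = 0 in K; the
    identity is specialized from the one over Z. *)
Lemma landen_row_b0_field (K : fieldType) n d (P : 'rV[K]_(ncoord d)) :
  rsubmx (landen_row n P) 0 0 = rsubmx P 0 0 ^+ n.+1.
Proof.
rewrite -mpeval_landen mxE -mpeval_tupleE landen_coords_b0 rmorphXn /= mpevalX.
by rewrite mxE.
Qed.

Lemma landen_row_a0_field (K : fieldType) n d (P : 'rV[K]_(ncoord d)) :
  lsubmx (landen_row n P) 0 0 = lsubmx P 0 0 * rsubmx P 0 0 ^+ n.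
Proof.
rewrite -mpeval_landen mxE -mpeval_tupleE landen_coords_a0 rmorphM rmorphXn /=.
by rewrite !mpevalX !mxE.
Qed.

Lemma landen_coords_homog n d i : tnth (landen_coords n d) i \is n.+1.-homog.
Proof.
apply: (@dhomog_scaling algC) => P; rewrite !mpeval_tupleE !mpeval_landen.
by rewrite landen_rowZ mxE.
Qed.

Definition landen_ratmap n d : ratmap (ncoord d) := RatMap
  (ex_intro _ n.+1 (landen_coords_homog n (d:=d)))
  (ex_intro _ (b0 d) (eq_ind_r (fun p => is_true (p != 0))
     (expf_neq0 n.+1 (mpolyXi_neq0 (b0 d))) (landen_coords_b0 n d))).

Lemma ratmap_eq_sym n (f g : ratmap n) : ratmap_eq f g -> ratmap_eq g f.
Proof. by move=> fg i j; rewrite mulrC -fg mulrC. Qed.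

Section LandenMap.

Variables (n d : nat).
Hypothesis d_gt0 : (0 < d)%N.

Lemma in_RatE (K : fieldType) (P : 'rV[K]_(ncoord d)) : in_Rat P <->
  coprimep (rev_poly (lsubmx P)) (rev_poly (rsubmx P)) &&
  (d < maxn (size (rev_poly (lsubmx P))) (size (rev_poly (rsubmx P))))%N.
Proof. by rewrite /in_Rat form_resultant_neq0. Qed.

Lemma in_Rat_den_neq0 (K : fieldType) (P : 'rV[K]_(ncoord d)) :
  in_Rat P -> rev_poly (rsubmx P) != 0.
Proof.
move/in_RatE => /andP[copr smax]; apply: contraTneq smax => q0.
move: copr; rewrite q0 size_poly0 maxn0 coprimep0 -size_poly_eq1 => /eqP ->.
by rewrite -leqNgt.
Qed.

(** The defining identity lives in L(w). Numerator and norm commute with the embedding of K in L,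
    and substituting w^m is injective, so the identity descends to K(z). *)
Lemma landen_transform_average (K : fieldType) (P : 'rV[K]_(ncoord d)) psi :
    rev_poly (rsubmx P) != 0 -> landen_transform n.+1 (phi_of P) psi ->
  exists L : fieldType, exists iota : {rmorphism K -> L}, exists2 zeta : L,
    n.+1.-primitive_root zeta &
    psi = (landen_num n (rev_poly (lsubmx P)) (rev_poly (rsubmx P)))%:F /
          (landen_den n (rev_poly (rsubmx P)))%:F.
Proof.
move=> q0 [L [iota [zeta [pz psiE]]]]; exists L, iota, zeta => //.
set p := rev_poly (lsubmx P) in q0 *; set q := rev_poly (rsubmx P) in q0 *.
have zX t : (1 < size (zeta ^+ t *: 'X : {poly L}))%N.
  by rewrite size_scale ?size_polyX // expf_neq0 // (prim_root_neq0 pz).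
have Xn : (1 < size ('X^(n.+1) : {poly L}))%N by rewrite size_polyXn.
have qi0 : map_poly iota q != 0 by rewrite map_poly_eq0.
have D0 : landen_den n q != 0.
  by rewrite -(map_poly_eq0 iota) map_landen_den (landen_den_eq0 pz).
apply: (ratfun_subst_inj (iota := iota) Xn); rewrite psiE ratfun_subst_frac //.
rewrite map_landen_num map_landen_den (landen_comp_frac pz) //.
by congr (_ * _); apply: eq_bigr => t _; rewrite ratfun_subst_frac.
Qed.

Lemma landen_map_landen : is_landen_map n.+1 (landen_ratmap n d).
Proof.
move=> K P psi n0 ratP tr deg_psi; have q0 := in_Rat_den_neq0 ratP.
have [L [iota [zeta pz psiE]]] := landen_transform_average q0 tr.
set p := rev_poly (lsubmx P) in q0 psiE; set q := rev_poly (rsubmx P) in q0 psiE.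
have qi0 : map_poly iota q != 0 by rewrite map_poly_eq0.
have sD : (size (landen_den n q) <= d.+1)%N.
  rewrite -(size_map_poly iota) map_landen_den (size_landen_den pz) size_map_poly.
  exact: size_rev_poly.
have sN : (size (landen_num n p q) <= d.+1)%N.
  rewrite -(size_map_poly iota) map_landen_num.
  by apply: (size_landen_num pz); rewrite ?size_map_poly ?size_rev_poly.
have D0 : landen_den n q != 0.
  by rewrite -(map_poly_eq0 iota) map_landen_den (landen_den_eq0 pz).
have NE := rev_poly_lsub_landen sN; have DE := rev_poly_rsub_landen sD.
exists (landen_row n P); split.
- apply/in_RatE; rewrite NE DE coprimepZl ?signr_eq0 // coprimepZr ?signr_eq0 //.
  by rewrite !size_scale ?signr_eq0 // -ratfun_deg_frac // -psiE; apply/eqP.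
- rewrite /phi_of !form_polyE NE DE psiE; apply/eqP.
  rewrite eq_frac ?scaler_eq0 ?signr_eq0 ?D0 //.
  by rewrite -scalerAl -scalerAr.
split; first by apply: contraNneq q0 => P0; rewrite /q P0 linear0 rev_poly0.
exists (landen_ratmap n d); rewrite mpeval_landen; split.
- by move=> i j; rewrite mulrC.
- apply: contraNneq D0 => F0; move: DE; rewrite F0 linear0 rev_poly0 => /esym/eqP.
  by rewrite scaler_eq0 signr_eq0.
by exists 1; rewrite ?oner_neq0 // scale1r.
Qed.

End LandenMap.

(* [form_resultant] over an arbitrary ring, for the same reason as [rev_poly]. *)
Definition gen_resultant (R : comNzRingType) d (P : 'rV[R]_(ncoord d)) : R :=
  let rows (a : 'rV[R]_d.+1) : 'M[R]_(d, d + d) :=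
    \matrix_(i, j) (if (i <= j <= i + d)%N then a 0 (inord (j - i)) else 0) in
  \det (col_mx (rows (lsubmx P)) (rows (rsubmx P))).

Lemma map_gen_resultant (R S : comNzRingType) (f : {rmorphism R -> S}) d
    (P : 'rV[R]_(ncoord d)) : f (gen_resultant P) = gen_resultant (map_mx f P).
Proof.
rewrite /gen_resultant -det_map_mx map_col_mx -map_lsubmx -map_rsubmx.
congr (\det (col_mx _ _)); apply/matrixP => i j; rewrite !mxE;
  by case: ifP => _; rewrite ?rmorph0 ?mxE.
Qed.

Lemma map_mpeval_vars (K : fieldType) n (P : 'rV[K]_n) :
  map_mx (mpeval P) (\row_i 'X_i) = P.
Proof. by apply/rowP => i; rewrite !mxE mpevalX. Qed.

(** Nonzero exactly where both the point and its image lie in Rat_d, so where the defining property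
    of R_{d,m,0} prescribes the value. *)
Definition generic_resultants n d : {mpoly int[ncoord d]} :=
  gen_resultant (\row_i 'X_i) * gen_resultant (landen_row n (\row_i 'X_i)).

Lemma mpeval_generic_resultants (K : fieldType) n d (P : 'rV[K]_(ncoord d)) :
    mpeval P (generic_resultants n d) =
  form_resultant (lsubmx P) (rsubmx P) *
  form_resultant (lsubmx (landen_row n P)) (rsubmx (landen_row n P)).
Proof.
transitivity (gen_resultant P * gen_resultant (landen_row n P)); last by [].
rewrite rmorphM; congr (_ * _); rewrite [LHS]map_gen_resultant.
  by rewrite map_mpeval_vars.
by rewrite map_landen_row map_mpeval_vars.
Qed.

Lemma phi_of_inj (K : fieldType) d (P Q : 'rV[K]_(ncoord d)) : (0 < d)%N ->
  in_Rat P -> in_Rat Q -> phi_of P = phi_of Q -> exists2 c, c != 0 & Q = c *: P.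
Proof.
move=> d0 rP rQ; have qP := in_Rat_den_neq0 d0 rP; have qQ := in_Rat_den_neq0 d0 rQ.
move/eqP; rewrite /phi_of !form_polyE eq_frac // => /eqP.
move: rP rQ => /(in_RatE d0)/andP[cP _] /(in_RatE d0)/andP[cQ _].
set p := rev_poly _ in cP *; set q' := rev_poly (rsubmx Q) in cQ qQ *.
set p' := rev_poly _ in cQ *; set q := rev_poly (rsubmx P) in cP qP *.
move=> eq_pq.
have : q %= q'.
  rewrite /eqp -(Gauss_dvdpr q' (_ : coprimep q p)) 1?coprimep_sym //.
  rewrite eq_pq dvdp_mull //.
  rewrite -(Gauss_dvdpr q (_ : coprimep q' p')) 1?coprimep_sym //.
  by rewrite -eq_pq dvdp_mull.
case/eqpP => -[c c'] /= /andP[c0 c'0] eq_qq'.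
have q'E : q' = (c / c') *: q.
  by apply: (scalerI c'0); rewrite -eq_qq' scalerA mulrCA divff // mulr1.
exists (c / c'); first by rewrite mulf_neq0 ?invr_eq0.
apply: row_eq_rev; rewrite linearZ rev_polyZ //=.
apply: (mulIf qP); rewrite -/p -/p' -/q -eq_pq q'E -scalerAr -scalerAl //.
Qed.

(** * Uniqueness and composition of the rational maps *)

Section Maps.

Variable d : nat.
Hypothesis d_gt0 : (0 < d)%N.

Lemma generic_resultants_neq0 n : generic_resultants n d != 0.
Proof.
have [zeta pz] := C_prim_root_exists (ltn0Sn n).
case: d d_gt0 => [//|e] d0; pose q : {poly algC} := ('X - 1%:P) ^+ e.+1.
have sq : size q = e.+2 by rewrite size_exp_XsubC.
have q0 : q != 0 by rewrite -size_poly_eq0 sq.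
have copr := landen_one_coprime e pz; rewrite -/q in copr.
pose P : 'rV[algC]_(ncoord e.+1) :=
  row_mx (\row_(i < e.+2) (1 : {poly algC})`_(e.+1 - i))
         (\row_(i < e.+2) q`_(e.+1 - i)).
have lP : rev_poly (lsubmx P) = 1 by rewrite row_mxKl rev_poly_row // size_poly1.
have rP : rev_poly (rsubmx P) = q by rewrite row_mxKr rev_poly_row // sq.
have P0 : rsubmx P != 0.
  by apply: contraNneq q0 => P0; rewrite -rP P0 rev_poly0.
suff : mpeval P (generic_resultants n e.+1) != 0.
  by apply: contraNneq => ->; rewrite rmorph0.
rewrite mpeval_generic_resultants.
rewrite mulf_neq0 // form_resultant_neq0 // !form_polyE.
  by rewrite lP rP coprime1p leq_max sq ltnSn orbT.
rewrite (rev_landen_l pz) // (rev_landen_r pz) lP rP.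
rewrite coprimepZl ?signr_eq0 // coprimepZr ?signr_eq0 // copr leq_max.
by rewrite !size_scale ?signr_eq0 // (size_landen_den pz) sq ltnSn orbT.
Qed.

(** At complex points off the hypersurface, [landen_row n P] is a transform of degree d, which
    prescribes the value of [g]. That value is taken by a representative [g'] nonzero at P, where
    [g] itself may vanish; hence the comparison by cross products. *)
Lemma landen_map_unique n g :
  is_landen_map n.+1 g -> ratmap_eq (landen_ratmap n d) g.
Proof.
move=> lg i j; have [zeta pz] := C_prim_root_exists (ltn0Sn n).
apply: (@mpoly_eq_off algC _ _ _ _ (generic_resultants_neq0 n)) => P.
rewrite mpeval_generic_resultants mulf_eq0 negb_or => /andP[rP rF].
have q0 := in_Rat_den_neq0 d_gt0 rP; have qF := in_Rat_den_neq0 d_gt0 rF.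
have P0 : rsubmx P != 0 by apply: contraNneq q0 => ->; rewrite rev_poly0.
have n0 : n.+1%:R != 0 :> algC by rewrite pnatr_eq0.
have deg : ratfun_deg (phi_of (landen_row n P)) = d.
  move/(in_RatE d_gt0): (rF) => h; apply/eqP.
  by rewrite ratfun_deg_frac ?size_rev_poly.
have tr : landen_transform n.+1 (phi_of P) (phi_of (landen_row n P)).
  exists algC, idfun, zeta; split=> //.
  rewrite /phi_of !form_polyE ratfun_subst_frac ?size_polyXn //.
  rewrite !map_poly_id // (rev_landen_l pz) // (rev_landen_r pz).
  have D0 : landen_den n (rev_poly (rsubmx P)) != 0 by rewrite (landen_den_eq0 pz).
  transitivity (
     (landen_num n (rev_poly (lsubmx P)) (rev_poly (rsubmx P)) \Po 'X^(n.+1))%:F /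
     (landen_den n (rev_poly (rsubmx P)) \Po 'X^(n.+1))%:F).
    apply/eqP; rewrite eq_frac ?comp_poly_eq0 ?size_polyXn ?scaler_eq0 ?signr_eq0 ?D0 //.
    by rewrite !comp_polyZ -scalerAl -scalerAr.
  rewrite (landen_comp_frac pz) //; congr (_ * _); apply: eq_bigr => t _.
  rewrite ratfun_subst_frac ?map_poly_id //.
  by rewrite size_scale ?size_polyX // expf_neq0 // (prim_root_neq0 pz).
have [Q [rQ phiQ [_ [g' [gg' g'0 [c c0 QE]]]]]] := lg _ _ _ n0 rP tr deg.
have [e e0 QF] := phi_of_inj d_gt0 rF rQ (esym phiQ).
pose u k := mpeval P (tnth g k); pose v k := landen_row n P 0 k.
have g'E k : mpeval P (tnth g' k) = c^-1 * e * v k.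
  rewrite mpeval_tupleE /v; move/rowP/(_ k): QE; rewrite QF !mxE => h.
  by rewrite -mulrA h mulKf.
have ce0 : c^-1 * e != 0 by rewrite mulf_neq0 ?invr_eq0.
rewrite !rmorphM /= !(mpeval_tupleE _ (landen_coords n d)) !mpeval_landen.
rewrite -/(v i) -/(v j) -/(u i) -/(u j).
have := congr1 (mpeval P) (gg' j i); rewrite !rmorphM /= -/(u i) -/(u j) !g'E.
by rewrite !(mulrCA _ (c^-1 * e)) => /(mulfI ce0) h; rewrite mulrC h mulrC.
Qed.

Lemma ratmap_eq_nonzero n (f g : ratmap n) i :
  ratmap_eq f g -> tnth f i != 0 -> tnth g i != 0.
Proof.
move=> fg fi; apply: contraTneq isT => gi.
have [j gj] := ratmap_neq0 g.
by have := fg i j; rewrite gi mulr0 => /eqP; rewrite mulf_eq0 (negPf fi) (negPf gj).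
Qed.

Lemma comp_homog n k e (p : {mpoly int[n]}) (c : {mpoly int[k]})
    (s t : n.-tuple {mpoly int[k]}) :
  p \is e.-homog -> (forall i, tnth s i = c * tnth t i) ->
  p \mPo s = c ^+ e * (p \mPo t).
Proof.
move=> hp st; rewrite !comp_mpolyE mulr_sumr; apply: eq_big_seq => m mp.
have <- : mdeg m = e by exact: dhomog_mf hp _ mp.
rewrite -scalerAr; congr (_ *: _); rewrite mdegE -prodrXr -big_split.
by apply: eq_bigr => i _; rewrite st exprMn.
Qed.

Lemma mpeval_landen_comp (F : fieldType) n k N (zeta : F)
    (P : 'rV[F]_(ncoord d)) i :
    N.+1 = (k.+1 * n.+1)%N -> N.+1.-primitive_root zeta -> rsubmx P != 0 ->
  mpeval P (tnth (landen_coords n d) i \mPo landen_coords k d) =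
  mpeval P (tnth (landen_coords N d) i).
Proof.
move=> NE pz P0; rewrite mpeval_comp !mpeval_tupleE.
by rewrite !mpeval_landen (landen_row_comp NE pz P0).
Qed.

Lemma landen_coords_comp n k N i : N.+1 = (k.+1 * n.+1)%N ->
  tnth (landen_coords n d) i \mPo landen_coords k d = tnth (landen_coords N d) i.
Proof.
move=> NE; have [zeta pz] := C_prim_root_exists (ltn0Sn N).
apply: (@mpoly_eq_off algC _ _ _ _ (mpolyXi_neq0 (b0 d))) => P; rewrite mpevalX => P0.
apply: (mpeval_landen_comp _ NE pz).
by apply: contraNneq P0 => /rowP/(_ ord0); rewrite !mxE => ->.
Qed.

Lemma landen_comp n k N (f g : ratmap (ncoord d)) : N.+1 = (k.+1 * n.+1)%N ->
    ratmap_eq (landen_ratmap n d) f -> ratmap_eq (landen_ratmap k d) g ->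
  ratmap_comp f g (landen_ratmap N d).
Proof.
move=> NE eq_f eq_g; exists (landen_ratmap n d); rewrite /=.
pose l := b0 d; have kl : tnth (landen_coords k d) l != 0.
  by rewrite landen_coords_b0 expf_neq0 // mpolyXi_neq0.
have gl : tnth g l != 0 := ratmap_eq_nonzero eq_g kl.
(* [g] is merely proportional to the coordinates for [k]. Cross-multiplying by the [b_0] coordinates
   makes the two tuples equal, and homogeneity pulls the multipliers out as powers of exponent
   n+1. *)
have compE i : tnth (landen_coords k d) l ^+ n.+1 * (tnth (landen_coords n d) i \mPo g) =
    tnth g l ^+ n.+1 * tnth (landen_coords N d) i.
  pose s := [tuple tnth g l * tnth (landen_coords k d) j | j < ncoord d].
  have hn := landen_coords_homog n i.
  have sF j : tnth s j = tnth g l * tnth (landen_coords k d) j by rewrite tnth_mktuple.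
  have sg j : tnth s j = tnth (landen_coords k d) l * tnth g j.
    by rewrite sF mulrC; exact: (eq_g j l).
  by rewrite -(landen_coords_comp i NE) -(comp_homog hn sF) -(comp_homog hn sg).
split; first exact: ratmap_eq_sym.
  exists l; rewrite tnth_mktuple; have := expf_neq0 n.+1 gl.
  apply: contraNneq => h; have := compE l; rewrite h mulr0 => /esym/eqP.
  by rewrite mulf_eq0 landen_coords_b0 (negPf (expf_neq0 N.+1 (mpolyXi_neq0 _))) orbF.
move=> i j; rewrite !tnth_mktuple /=.
apply: (mulfI (expf_neq0 n.+1 kl)); rewrite !mulrA !compE -!mulrA; congr (_ * _).
by rewrite mulrC.
Qed.

End Maps.

Lemma ratmap_at_landen (K : fieldType) n d (f : ratmap (ncoord d))
    (P : 'rV[K]_(ncoord d)) :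
    ratmap_eq (landen_ratmap n d) f -> rsubmx P 0 0 != 0 ->
  ratmap_at f P (landen_row n P).
Proof.
move=> eq_f P0; split; first by apply: contraNneq P0 => ->; rewrite !mxE.
exists (landen_ratmap n d); rewrite mpeval_landen; split; first exact: ratmap_eq_sym.
  apply: contraNneq (expf_neq0 n.+1 P0) => F0.
  by rewrite -landen_row_b0_field F0 !mxE.
by exists 1; rewrite ?oner_neq0 // scale1r.
Qed.

(** * Dominance and algebraic degree *)

Lemma landen_dominant n d (f : ratmap (ncoord d)) :
  ratmap_eq (landen_ratmap n d) f -> ratmap_dominant f.
Proof.
move=> eq_f e p _ p0; have [zeta pz] := C_prim_root_exists (ltn0Sn n).
have D0 : 'X_(b0 d) * 'X_(bd d) != 0 :> {mpoly int[ncoord d]}.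
  by rewrite mulf_neq0 // mpolyXi_neq0.
apply: (@mpeval_eq0_off algC _ _ _ D0) => Q.
rewrite rmorphM /= !mpevalX mulf_eq0 negb_or => /andP[Q0 Qd].
have [|| P PQ P0] := @landen_row_surj _ n zeta d Q pz; rewrite ?mxE //.
apply: (p0 algC P); rewrite -PQ; apply: ratmap_at_landen => //.
by rewrite P0 rootC_eq0 // mxE.
Qed.

(** Leading monomials multiply over Z, so that of a factor divides that of the product. *)
Lemma mlead_dvd_Xn n (c q : {mpoly int[n]}) (a : int) i k : a != 0 ->
  a *: 'X_i ^+ k = c * q -> (mlead c <= U_(i) *+ k)%MM.
Proof.
move=> a0 E; have cq0 : c * q != 0.
  by rewrite -E -mul_mpolyC mulf_neq0 ?mpolyC_eq0 ?expf_neq0 ?mpolyXi_neq0.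
move: (cq0); rewrite mulf_eq0 negb_or => /andP[c0 q0].
have := congr1 (fun p : {mpoly int[n]} => mlead p) E.
rewrite mleadZ // mleadX ?mpolyXi_neq0 // mleadXm mleadM // => ->.
exact: lem_addr.
Qed.

(** The leading monomial of a common factor divides powers of both [b_0] and [b_d], which are
    distinct variables as d > 0; it is therefore 1, and the factor is a constant. *)
Lemma landen_degree n d (f : ratmap (ncoord d)) : (0 < d)%N ->
  ratmap_eq (landen_ratmap n d) f -> algebraic_degree f n.+1.
Proof.
move=> d0 eq_f; exists (landen_ratmap n d); split.
- exact: ratmap_eq_sym.
- exact: landen_coords_homog.
move=> c cdvd; have [q0 E0] := cdvd (b0 d); have [qd Ed] := cdvd (bd d).
rewrite /= landen_coords_b0 in E0; rewrite /= landen_coords_bd in Ed.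
have l0 := @mlead_dvd_Xn _ c q0 1 (b0 d) n.+1 (oner_neq0 _).
rewrite scale1r in l0; have {}l0 := l0 E0.
have s0 : (-1) ^+ (n * d) != 0 :> int by rewrite signr_eq0.
have ld := @mlead_dvd_Xn _ c qd _ (bd d) n.+1 s0.
have {}ld : (mlead c <= U_(bd d) *+ n.+1)%MM.
  by apply: ld; rewrite -Ed -mul_mpolyC rmorphXn rmorphN1.
have lc : mlead c = 0%MM.
  apply/mnmP => i; rewrite mnm0E; apply/eqP; rewrite -leqn0.
  have := mnm_lepP l0 i; have := mnm_lepP ld i.
  rewrite !mulmnE !mnm1E; case: eqP => [<-|_]; last by rewrite mul0n.
  case: eqP => [/rshift_inj/(congr1 val) /= h|_].
    by exfalso; move: (d0); rewrite -h.
  by rewrite mul0n.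
have c0 : c != 0.
  apply: contraTneq (expf_neq0 n.+1 (mpolyXi_neq0 (b0 d))) => c0.
  by rewrite E0 c0 mul0r eqxx.
have cE : c = (c@_0)%:MP.
  by apply: msize1_polyC; rewrite -mlead_deg // lc mdeg0.
(* Over Z a constant factor need not be a unit; this one is, since the coefficient of b_0^(n+1) is
   1. *)
have := congr1 (mcoeff (U_(b0 d) *+ n.+1)) E0; rewrite mpolyXn mcoeffX eqxx.
rewrite cE mul_mpolyC mcoeffZ => u; apply/unitrP.
exists (q0@_(U_(b0 d) *+ n.+1))%:MP.
by rewrite [X in X = _ /\ _]mulrC -!mpolyCM -u.
Qed.

(** * Affine charts *)

Section Chart.

Variables (d N : nat).
(** Both loci are treated at once. Charts over all commutative rings are required because the
    induced maps are read off the image of the row of variables over [{mpoly int[N]}]. [chart_lift]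
    places preimages with [b_0 = 1] in the chart, and [jd] locates [b_d], whose nonvanishing
    [landen_row_surj] requires. *)
Variable chart : forall R : comNzRingType, 'rV[R]_N -> 'rV[R]_(ncoord d).
Variable unchart : forall R : comNzRingType, 'rV[R]_(ncoord d) -> 'rV[R]_N.
Hypothesis map_chart : forall (R S : comNzRingType) (f : {rmorphism R -> S}) x,
  map_mx f (chart x) = chart (map_mx f x).
Hypothesis map_unchart : forall (R S : comNzRingType) (f : {rmorphism R -> S}) P,
  map_mx f (unchart P) = unchart (map_mx f P).
Hypothesis chartK : forall R, cancel (@chart R) (@unchart R).
Hypothesis chart_b0 : forall R x, rsubmx (@chart R x) 0 0 = 1.
Variable jd : 'I_N.
Hypothesis chart_bd : forall R x, rsubmx (@chart R x) 0 ord_max = x 0 jd.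
Hypothesis chart_lift : forall (K : fieldType) n (P : 'rV[K]_(ncoord d)) y,
  landen_row n P = chart y -> rsubmx P 0 0 = 1 -> chart (unchart P) = P.
Hypothesis landen_chart : forall (K : fieldType) n (x : 'rV[K]_N),
  chart (unchart (landen_row n (chart x))) = landen_row n (chart x).

Lemma chart_landen_spec n : {h : polyendo N | forall (K : fieldType) (x : 'rV[K]_N),
  mpeval_tuple h x = unchart (landen_row n (chart x))}.
Proof.
exists [tuple unchart (landen_row n (chart (\row_j 'X_j))) 0 i | i < N] => K x.
rewrite -{2}(map_mpeval_vars x) -map_chart -map_landen_row -map_unchart.
by apply/rowP => i; rewrite [LHS]mxE [RHS]mxE tnth_mktuple.
Qed.

Definition chart_landen n := sval (chart_landen_spec n).

Lemma mpeval_chart_landen (K : fieldType) n (x : 'rV[K]_N) :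
  mpeval_tuple (chart_landen n) x = unchart (landen_row n (chart x)).
Proof. exact: (svalP (chart_landen_spec n)). Qed.

Lemma chart_landen_comp n k M : M.+1 = (k.+1 * n.+1)%N ->
  polyendo_comp (chart_landen n) (chart_landen k) = chart_landen M.
Proof.
move=> ME; apply: eq_from_tnth => i; rewrite tnth_mktuple.
have [zeta pz] := C_prim_root_exists (ltn0Sn M).
apply: (@mpoly_eq_off algC _ 1 _ _ (oner_neq0 _)) => x _.
rewrite mpeval_comp !mpeval_tupleE !mpeval_chart_landen landen_chart.
rewrite (landen_row_comp ME pz) //.
apply: contraNneq (oner_neq0 algC) => c0.
by rewrite -(chart_b0 x) c0 mxE.
Qed.

(** Off [b_d = 0], the preimage of a chart point has as [b_0] the chosen root of 1, which is 1, so
    it lies in the chart again. *)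
Lemma chart_landen_dominant n : polyendo_dominant (chart_landen n).
Proof.
move=> p p0; have [zeta pz] := C_prim_root_exists (ltn0Sn n).
apply: (@mpeval_eq0_off algC _ _ _ (mpolyXi_neq0 jd)) => y; rewrite mpevalX => yd.
have [|| P PE P0] := @landen_row_surj _ n zeta d (chart y) pz.
- by rewrite chart_b0 oner_neq0.
- by rewrite chart_bd.
rewrite chart_b0 rootC1 // in P0.
have -> : y = mpeval_tuple (chart_landen n) (unchart P); last exact: p0.
by rewrite mpeval_chart_landen (chart_lift PE P0) PE chartK.
Qed.

Lemma chart_landen_induces n (f : ratmap (ncoord d)) :
  ratmap_eq (landen_ratmap n d) f ->
  induces (fun K : fieldType => @chart K) f (chart_landen n).
Proof.
move=> eq_f K x; rewrite mpeval_chart_landen landen_chart.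
by apply: ratmap_at_landen => //; rewrite chart_b0 oner_neq0.
Qed.

Lemma landen_induces (R : nat -> ratmap (ncoord d)) :
    (forall n, ratmap_eq (landen_ratmap n d) (R n.+1)) ->
  induces_commuting_dominant (fun K : fieldType => @chart K) R.
Proof.
move=> RE; exists (fun m => chart_landen m.-1); split.
- by case=> // n _; exact: chart_landen_induces.
- case=> // n [//|k] _ _.
  rewrite (@chart_landen_comp n k (k.+1 * n.+1).-1) //.
  by rewrite (@chart_landen_comp k n (k.+1 * n.+1).-1) // mulnC.
- by case=> // n _; exact: chart_landen_dominant.
Qed.

End Chart.

Definition cons_row (R : comNzRingType) d (c : R) (v : 'rV[R]_d) : 'rV[R]_d.+1 :=
  row_mx (const_mx c : 'rV[R]_1) v.

Definition behead_row (R : comNzRingType) d (v : 'rV[R]_d.+1) : 'rV[R]_d :=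
  rsubmx (v : 'rV[R]_(1 + d)).

Lemma cons_row0 (R : comNzRingType) d (c : R) (v : 'rV[R]_d) : cons_row c v 0 0 = c.
Proof.
transitivity (row_mx (const_mx c : 'rV[R]_1) v 0 (lshift d 0)).
  by congr (fun_of_matrix _ 0 _); apply: val_inj.
by rewrite row_mxEl mxE.
Qed.

Lemma cons_row_max (R : comNzRingType) d (c : R) (v : 'rV[R]_d.+1) :
  cons_row c v 0 ord_max = v 0 ord_max.
Proof.
rewrite -(row_mxEr (const_mx c : 'rV[R]_1) v 0 ord_max).
by congr (fun_of_matrix _ 0 _); apply: val_inj.
Qed.

Lemma behead_cons_row (R : comNzRingType) d (c : R) (v : 'rV[R]_d) :
  behead_row (cons_row c v) = v.
Proof. by rewrite /behead_row row_mxKr. Qed.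

Lemma cons_behead_row (R : comNzRingType) d (v : 'rV[R]_d.+1) c : v 0 0 = c ->
  cons_row c (behead_row v) = v.
Proof.
move=> vc; rewrite /cons_row.
have -> : const_mx c = lsubmx (v : 'rV[R]_(1 + d)); last by rewrite hsubmxK.
apply/rowP => i; rewrite !mxE -vc; congr (fun_of_matrix _ 0 _); apply: val_inj.
by rewrite (ord1 i).
Qed.

Lemma map_cons_row (R S : comNzRingType) (f : {rmorphism R -> S}) d c (v : 'rV[R]_d) :
  map_mx f (cons_row c v) = cons_row (f c) (map_mx f v).
Proof. by rewrite /cons_row -map_const_mx -map_row_mx. Qed.

Lemma map_behead_row (R S : comNzRingType) (f : {rmorphism R -> S}) d (v : 'rV[R]_d.+1) :
  map_mx f (behead_row v) = behead_row (map_mx f v).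
Proof. by rewrite /behead_row map_rsubmx. Qed.

(** Convertible to [chart_b0] over a field, but available over every commutative ring. *)
Definition affine_b0 d (R : comNzRingType) (x : 'rV[R]_(d.+1 + d)) :
    'rV[R]_(ncoord d) :=
  row_mx (lsubmx x) (cons_row 1 (rsubmx x)).

Definition coords_b0 d (R : comNzRingType) (P : 'rV[R]_(ncoord d)) :
    'rV[R]_(d.+1 + d) :=
  row_mx (lsubmx P) (behead_row (rsubmx P)).

Definition affine_a0_b0 d (R : comNzRingType) (x : 'rV[R]_(d + d)) :
    'rV[R]_(ncoord d) :=
  row_mx (cons_row 0 (lsubmx x)) (cons_row 1 (rsubmx x)).

Definition coords_a0_b0 d (R : comNzRingType) (P : 'rV[R]_(ncoord d)) :
    'rV[R]_(d + d) :=
  row_mx (behead_row (lsubmx P)) (behead_row (rsubmx P)).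

Lemma landen_induces_b0 d (R : nat -> ratmap (ncoord d)) : (0 < d)%N ->
    (forall n, ratmap_eq (landen_ratmap n d) (R n.+1)) ->
  induces_commuting_dominant (@chart_b0 d) R.
Proof.
(* As d > 0, [b_d] differs from the normalized [b_0] and survives as the last chart coordinate. *)
case: d R => [//|d] R _.
apply: (@landen_induces _ _ (@affine_b0 d.+1) (@coords_b0 d.+1) _ _ _ _
  (rshift d.+2 ord_max)).
- by move=> S T f x; rewrite map_row_mx map_cons_row map_lsubmx map_rsubmx rmorph1.
- by move=> S T f P; rewrite map_row_mx map_behead_row map_lsubmx map_rsubmx.
- by move=> S x; rewrite /coords_b0 row_mxKl row_mxKr behead_cons_row hsubmxK.
- by move=> S x; rewrite row_mxKr cons_row0.
- by move=> S x; rewrite row_mxKr cons_row_max mxE.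
- move=> K n P y _ P0; rewrite /affine_b0 row_mxKl row_mxKr.
  by rewrite cons_behead_row ?hsubmxK.
move=> K n x; rewrite [LHS]/affine_b0 row_mxKl row_mxKr cons_behead_row ?hsubmxK //.
by rewrite landen_row_b0_field row_mxKr cons_row0 expr1n.
Qed.

Lemma landen_induces_a0_b0 d (R : nat -> ratmap (ncoord d)) : (0 < d)%N ->
    (forall n, ratmap_eq (landen_ratmap n d) (R n.+1)) ->
  induces_commuting_dominant (@chart_a0_b0 d) R.
Proof.
case: d R => [//|d] R _.
apply: (@landen_induces _ _ (@affine_a0_b0 d.+1) (@coords_a0_b0 d.+1) _ _ _ _
  (rshift d.+1 ord_max)).
- move=> S T f x; rewrite map_row_mx !map_cons_row map_lsubmx map_rsubmx.
  by rewrite rmorph1 rmorph0.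
- by move=> S T f P; rewrite map_row_mx !map_behead_row map_lsubmx map_rsubmx.
- by move=> S x; rewrite /coords_a0_b0 row_mxKl row_mxKr !behead_cons_row hsubmxK.
- by move=> S x; rewrite row_mxKr cons_row0.
- by move=> S x; rewrite row_mxKr cons_row_max mxE.
- move=> K n P y PE P0; rewrite /affine_a0_b0 row_mxKl row_mxKr.
  rewrite !cons_behead_row ?hsubmxK //.
  (* The image has [a_0 * b_0 ^+ n] as its first coordinate, so with [b_0 = 1] the preimage inherits
     [a_0 = 0]. *)
  have := landen_row_a0_field n P; rewrite PE row_mxKl cons_row0 P0 expr1n mulr1.
  by move<-.
move=> K n x; rewrite [LHS]/affine_a0_b0 row_mxKl row_mxKr !cons_behead_row ?hsubmxK //.
  by rewrite landen_row_b0_field row_mxKr cons_row0 expr1n.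
by rewrite landen_row_a0_field row_mxKl cons_row0 mul0r.
Qed.

Theorem corollary4 (d : nat) (hd : (0 < d)%N) :
  (* for each m >= 1, the rational map R_{d,m,0} exists and is unique *)
  (forall m : nat, (0 < m)%N ->
     exists f : ratmap (ncoord d), is_landen_map m f /\
       forall g : ratmap (ncoord d), is_landen_map m g -> ratmap_eq f g) /\
  forall R : nat -> ratmap (ncoord d),
    (forall m : nat, (0 < m)%N -> is_landen_map m (R m)) ->
    [/\ forall m k : nat, (0 < m)%N -> (0 < k)%N -> ratmap_commute (R m) (R k),
        forall m : nat, (0 < m)%N -> ratmap_dominant (R m),
        forall m : nat, (0 < m)%N -> algebraic_degree (R m) m,
        induces_commuting_dominant (@chart_b0 d) R &
        induces_commuting_dominant (@chart_a0_b0 d) R].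
Proof.
split=> [[//|n] _ | R landenR].
  exists (landen_ratmap n d); split; first exact: landen_map_landen.
  by move=> g; exact: landen_map_unique.
(* Uniqueness reduces an arbitrary family with the defining property to the explicit maps, up to
   proportionality. *)
have RE n : ratmap_eq (landen_ratmap n d) (R n.+1).
  by apply: landen_map_unique => //; exact: landenR.
split.
- move=> [//|n] [//|k] _ _; exists (landen_ratmap (k.+1 * n.+1).-1 d).
  split; first exact: (landen_comp (erefl _) (RE n) (RE k)).
  by apply: (landen_comp _ (RE k) (RE n)); rewrite [RHS]mulnC.
- by case=> // n _; exact: landen_dominant (RE n).
- by case=> // n _; exact: landen_degree (RE n).
- exact: landen_induces_b0.
exact: landen_induces_a0_b0.
Qed.
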